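(* Let $f\in L^2(\Omega)$ and, for each $n\ge1$, let $u_n\in W_{Dir}$ be a solution of the Dirichlet problem $$ \begin{aligned} f(x) ={}& \chi_{A_n}(x)\int_{A_n} J(x,y)(u_n(y)-u_n(x))\,dy + \chi_{A_n}(x)\int_{B_n} R(x,y)(u_n(y)-u_n(x))\,dy\\ &+\chi_{B_n}(x)\int_{A_n} R(x,y)(u_n(y)-u_n(x))\,dy+\chi_{B_n}(x)\int_{B_n} G(x,y)(u_n(y)-u_n(x))\,dy,\qquad x\in\Omega, \end{aligned} $$ with $u_n\equiv0$ outside $\Omega$. Assume that $\chi_{A_n}\to X$ weakly-* in $L^\infty(\mathbb{R}^N)$ as $n\to\infty$. Then there exists a unique pair $(u_A,u_B)\in L^2(\Omega)\times L^2(\Omega)$, extended by $u_A(x)=u_B(x)=0$ for $x\in\mathbb{R}^N\setminus\Omega$, with $$\chi_{A_n}u_n\rightharpoonup u_A\quad\text{and}\quad\chi_{B_n}u_n\rightharpoonup u_B\quad\text{weakly in }L^2(\Omega),$$ such that, for $x\in\Omega$, $u_A$ and $u_B$ satisfy the system $$ X(x)f(x)=\int_{\mathbb{R}^N}J(x,y)\big[X(x)u_A(y)-X(y)u_A(x)\big]dy+\int_{\mathbb{R}^N}R(x,y)\big[X(x)u_B(y)-u_A(x)(1-X(y))\big]dy, $$ $$ (1-X(x))f(x)=\int_{\mathbb{R}^N}R(x,y)\big[u_A(y)(1-X(x))-u_B(x)X(y)\big]dy+\int_{\mathbb{R}^N}G(x,y)\big[u_B(y)(1-X(x))-u_B(x)(1-X(y))\big]dy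 . $$
   Context: $\Omega\subset\mathbb{R}^N$ is a bounded domain (open, connected). The kernels $V=J,G,R$ each satisfy: $V:\mathbb{R}^N\times\mathbb{R}^N\to\mathbb{R}$ is continuous and non-negative, $V(x,x)>0$ for every $x$, $V(x,y)=V(y,x)$ for all $x,y$, and $\int_{\mathbb{R}^N}V(x,y)\,dy=1$ for every $x$. For each $n\ge1$, $A_n,B_n$ are measurable sets with $\mathbb{R}^N=A_n\cup B_n$ and $A_n\cap B_n=\emptyset$ (a partition of the whole space); $\chi_E$ denotes the characteristic function of $E$. $X\in L^\infty(\mathbb{R}^N)$. $W_{Dir}=\{u\in L^2(\mathbb{R}^N): u=0\text{ in }\mathbb{R}^N\setminus\Omega\}$. Equations are understood for a.e. $x\in\Omega$. *)

(* Defs.v *)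
From HB Require Import structures.
From mathcomp Require Import all_boot all_order all_algebra.
From mathcomp Require Import all_classical all_reals all_analysis.
From mathcomp Require Import measurable_realfun ess_sup_inf.

Set Implicit Arguments.
Unset Strict Implicit.
Unset Printing Implicit Defensive.

Import Order.TTheory GRing.Theory Num.Theory.
Import numFieldNormedType.Exports.

Local Open Scope classical_set_scope.
Local Open Scope ring_scope.

(* The Lebesgue measure on R^n = 'rV[R]_n.  It is the completion (Caratheodory
   extension) of a measure on the Borel sets that is built by induction on n:
   dirac in dimension 0, then the product of the one-dimensional Lebesgue
   measure with the n-dimensional one. *)
Section borel.
Context {R : realType}.

(* Generators of the product sigma-algebra, which is the Borel one
   (see open_measurable_rV). *)
Definition coord_sets n : set (set 'rV[R]_n) :=
  [set A | exists i, exists2 B : set R,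
     @measurable _ (measurableTypeR R) B & A = [set v : 'rV[R]_n | B (v ord0 i)]].

Definition borel_rV n := g_sigma_algebraType (@coord_sets n).

HB.instance Definition _ n := Measurable.on (borel_rV n).

Definition cons_rV n (p : measurableTypeR R * borel_rV n) : borel_rV n.+1 :=
  (\row_i (if unlift ord0 i is Some j then (p.2 : 'rV[R]_n) ord0 j else p.1)).

Definition uncons_rV n (v : borel_rV n.+1) : measurableTypeR R * borel_rV n :=
  ((v : 'rV[R]_n.+1) ord0 ord0,
   (\row_j (v : 'rV[R]_n.+1) ord0 (lift ord0 j)) : 'rV[R]_n).

Lemma cons_rVK n : cancel (@cons_rV n) (@uncons_rV n).
Proof.
move=> [x v]; rewrite /cons_rV /uncons_rV/=; congr pair.
  by rewrite mxE unlift_none.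
by apply/rowP => j; rewrite !mxE liftK.
Qed.

Lemma uncons_rVK n : cancel (@uncons_rV n) (@cons_rV n).
Proof.
move=> v; apply/rowP => i; rewrite mxE.
by case: unliftP => [j ->|->]/=; rewrite ?mxE.
Qed.

Lemma measurable_coord n (i : 'I_n) :
  measurable_fun setT
    ((fun v => (v : 'rV[R]_n) ord0 i) : borel_rV n -> measurableTypeR R).
Proof.
by move=> _ B mB; rewrite setTI; apply: sub_sigma_algebra; exists i, B.
Qed.

Lemma measurable_fun_rV d (T : measurableType d) n (f : T -> borel_rV n) :
  (forall i, measurable_fun setT
    ((fun t => (f t : 'rV[R]_n) ord0 i) : T -> measurableTypeR R)) ->
  measurable_fun setT f.
Proof.
move=> mf; apply: (measurability (@coord_sets n : set (set (borel_rV n)))) => //.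
by move=> _ [_ [i [B mB ->]] <-]; exact: mf.
Qed.

Lemma measurable_cons_rV n : measurable_fun setT (@cons_rV n).
Proof.
apply: measurable_fun_rV => i; rewrite /cons_rV.
case: (unliftP ord0 i) => [j ->|->].
- rewrite (_ : (fun _ => _) =
      (fun v => (v : 'rV[R]_n) ord0 j) \o (snd : _ -> borel_rV n)).
    by apply: measurableT_comp => //; exact: measurable_coord.
  by apply/funext => p /=; rewrite mxE liftK.
- rewrite (_ : (fun _ => _) = fst)//.
  by apply/funext => p /=; rewrite mxE unlift_none.
Qed.

Lemma measurable_uncons_rV n : measurable_fun setT (@uncons_rV n).
Proof.
apply/measurable_fun_pairP; split => /=; first exact: measurable_coord.
apply: measurable_fun_rV => j.
rewrite (_ : (fun _ => _) =
    fun v : borel_rV n.+1 => (v : 'rV[R]_n.+1) ord0 (lift ord0 j)).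
  exact: measurable_coord.
by apply/funext => v /=; rewrite mxE.
Qed.


HB.instance Definition _ n := isMeasurableFun.Build _ _ _ _ (@cons_rV n)
  (@measurable_cons_rV n).

Section step.
Context (leb : {sigma_finite_measure set (measurableTypeR R) -> \bar R}).
Context n (mu : {sigma_finite_measure set (borel_rV n) -> \bar R}).

Definition lebesgue_step : set (borel_rV n.+1) -> \bar R :=
  pushforward (leb \x mu)%E (@cons_rV n).

Let step0 : lebesgue_step set0 = 0%E.
Proof. exact: measure0. Qed.

Let step_ge0 A : (0 <= lebesgue_step A)%E.
Proof. exact: measure_ge0. Qed.

Let step_sigma_additive : semi_sigma_additive lebesgue_step.
Proof. exact: measure_semi_sigma_additive. Qed.

HB.instance Definition _ := isMeasure.Build _ _ _ lebesgue_step
  step0 step_ge0 step_sigma_additive.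

Let step_sigma_finite : sigma_finite setT lebesgue_step.
Proof.
have /sigma_finiteP[F [FT ndF Foo]] := sigma_finiteT leb.
have /sigma_finiteP[G [GT ndG Goo]] := sigma_finiteT mu.
exists (fun k => @uncons_rV n @^-1` (F k `*` G k)).
  apply/esym/seteqP; split => // v _.
  have [k _ Fk] : (\bigcup_k F k) (uncons_rV v).1 by rewrite -FT.
  have [l _ Gl] : (\bigcup_k G k) (uncons_rV v).2 by rewrite -GT.
  exists (maxn k l) => //; split.
  - by move: Fk; exact/subsetPset/ndF/leq_maxl.
  - by move: Gl; exact/subsetPset/ndG/leq_maxr.
move=> k; have [mF Fkoo] := Foo k; have [mG Gkoo] := Goo k; split.
  rewrite -[X in measurable X]setTI.
  by apply: measurable_uncons_rV => //; exact: measurableX.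
rewrite /lebesgue_step /pushforward -comp_preimage.
rewrite (_ : _ \o _ = id); last by apply/funext => p /=; exact: cons_rVK.
by rewrite preimage_id product_measure1E// lte_mul_pinfty// ge0_fin_numE.
Qed.

HB.instance Definition _ := Measure_isSigmaFinite.Build _ _ _ lebesgue_step
  step_sigma_finite.

End step.

Fixpoint borel_lebesgue n : {sigma_finite_measure set (borel_rV n) -> \bar R} :=
  match n with
  | 0 => dirac ((0 : 'rV[R]_0) : borel_rV 0)
  | n'.+1 => lebesgue_step (@lebesgue_measure R) (borel_lebesgue n')
  end.

End borel.

Section lebesgue.
Context {R : realType} {n : nat}.

(* From here on [measurable] on 'rV[R]_n means Lebesgue measurable. *)
HB.instance Definition _ := Measurable.copy 'rV[R]_n
  (caratheodory_type (mu_ext (@borel_lebesgue R n))).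

Definition lebesgue_rV : set 'rV[R]_n -> \bar R :=
  @completed_measure_extension _ (borel_rV n) R (borel_lebesgue n).

HB.instance Definition _ := Measure.copy lebesgue_rV
  (@completed_measure_extension _ (borel_rV n) R (borel_lebesgue n)).

Let lebesgue_rV_sigma_finite : sigma_finite setT lebesgue_rV.
Proof.
exact/completed_measure_extension_sigma_finite/sigma_finiteT.
Qed.

HB.instance Definition _ := Measure_isSigmaFinite.Build _ _ _ lebesgue_rV
  lebesgue_rV_sigma_finite.

End lebesgue.
Arguments lebesgue_rV {R n}.

Section lebesgue_facts.
Context {R : realType}.

Lemma borel_measurable n (A : set (borel_rV n)) :
  measurable A -> measurable (A : set 'rV[R]_n).
Proof. by move=> mA; apply: sub_caratheodory; exact: sub_sigma_algebra. Qed.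

Lemma lebesgue_rVE n (A : set (borel_rV n)) : measurable A ->
  lebesgue_rV (A : set 'rV[R]_n) = borel_lebesgue n A.
Proof. exact: measurable_mu_extE. Qed.

Lemma lebesgue_rV_complete n : measure_is_complete (@lebesgue_rV R n).
Proof. exact: measure_is_complete_caratheodory. Qed.

Lemma lebesgue_rV_prod n (B : 'I_n -> set (measurableTypeR R)) :
  (forall i, measurable (B i)) ->
  lebesgue_rV [set v : 'rV[R]_n | forall i, B i (v ord0 i)] =
  (\prod_(i < n) lebesgue_measure (B i))%E.
Proof.
move=> mB.
have mbox m (C : 'I_m -> set (measurableTypeR R)) : (forall i, measurable (C i)) ->
    measurable ([set v : 'rV[R]_m | forall i, C i (v ord0 i)] : set (borel_rV m)).
  move=> mC; rewrite (_ : [set _ | _] =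
      \bigcap_(i in [set: 'I_m]) [set v : 'rV[R]_m | C i (v ord0 i)]); last first.
    by apply/seteqP; split => v /= h i; [move=> _; exact: h|exact: h].
  apply: fin_bigcap_measurable => // i _.
  by apply: sub_sigma_algebra; exists i, (C i).
rewrite lebesgue_rVE; last exact: mbox.
elim: n B mB => [|n IH] B mB /=.
  rewrite big_ord0 diracE mem_set//=; first by case.
have mt := mbox n (fun i => B (lift ord0 i)) (fun i => mB _).
rewrite big_ord_recl -(IH (fun i => B (lift ord0 i)))// -(product_measure1E _ _ (mB _) mt).
rewrite /lebesgue_step /pushforward; congr (_ _).
apply/seteqP; split => -[x v] /=.
  move=> h; split => [|i].
    by have := h ord0; rewrite mxE unlift_none.
  by have := h (lift ord0 i); rewrite mxE liftK.
move=> [Bx Bv] i; rewrite mxE; case: (unliftP ord0 i) => [j ->|->] //=.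
Qed.

Lemma open_measurable_rV n (U : set 'rV[R]_n) : open U -> measurable U.
Proof.
move=> oU; apply: borel_measurable.
pose box (p : 'rV[rat]_n * nat) := [set v : 'rV[R]_n |
  forall i, `|ratr (p.1 ord0 i) - v ord0 i| < p.2.+1%:R^-1].
have -> : U = \bigcup_(p in [set p | box p `<=` U]) box p.
  apply/seteqP; split => [v Uv|v [p pU]]; last exact: pU.
  have /nbhs_ballP[e /= e0 veU] := open_nbhs_nbhs (conj oU Uv).
  have e20 : 0 < e / 2 by rewrite divr_gt0.
  pose k := Num.truncn (e / 2)^-1.
  have ke : k.+1%:R^-1 < e / 2.
    by rewrite -[ltRHS]invrK ltf_pV2 ?posrE ?invr_gt0// truncnS_gt.
  have qP i : exists q : rat, `|ratr q - v ord0 i| < k.+1%:R^-1.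
    have /rat_in_itvoo[q] : v ord0 i - k.+1%:R^-1 < v ord0 i + k.+1%:R^-1.
      by rewrite ltrBlDr -addrA ltrDl addr_gt0// invr_gt0.
    by rewrite in_itv/= => qv; exists q; rewrite ltr_distl.
  have [q qv] := choice qP.
  exists (\row_i q i, k) => /=; last by move=> i; rewrite mxE.
  move=> w wq; apply: veU; split => // i j; rewrite ord1.
  have := wq j; rewrite mxE => wqj.
  rewrite /ball/= (splitr e) (le_lt_trans (ler_distD (ratr (q j)) _ _))//.
  by rewrite ltrD// ?(lt_trans _ ke)// distrC.
rewrite bigcup_mkcond; apply: countable_bigcupT_measurable => // p.
case: ifPn => // _; rewrite (_ : box p = \bigcap_(i in [set: 'I_n])
    [set v : 'rV[R]_n | `|ratr (p.1 ord0 i) - v ord0 i| < p.2.+1%:R^-1]); last first.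
  by apply/seteqP; split => v /= h i; [move=> _; exact: h|exact: h].
apply: fin_bigcap_measurable => // i _; apply: sub_sigma_algebra.
exists i, (ball (ratr (p.1 ord0 i) : R) p.2.+1%:R^-1) => //.
exact: (open_measurable (ball_open _ _)).
Qed.

End lebesgue_facts.

Section nonlocal.
Context {R : realType} {N : nat}.
Local Notation Rn := 'rV[R]_N.
Local Notation leb := (@lebesgue_rV R N).

Definition nonlocal_kernel (V : Rn -> Rn -> R) : Prop :=
  [/\ continuous (fun p : Rn * Rn => V p.1 p.2),
      forall x y, 0 <= V x y,
      forall x, 0 < V x x,
      forall x y, V x y = V y x &
      forall x, (\int[leb]_y (V x y)%:E = 1)%E].

(* L^2(Omega), for functions given on the whole space: values outside Omega
   are irrelevant. *)
Definition L2 (Omega : set Rn) (u : Rn -> R) : Prop :=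
  patch (fun=> 0) Omega u \in Lfun leb 2%:E.

Definition W_Dir (Omega : set Rn) (u : Rn -> R) : Prop :=
  u \in Lfun leb 2%:E /\ {ae leb, forall x, ~ Omega x -> u x = 0}.

Definition weak_cvg_L2 (Omega : set Rn) (v : (Rn -> R)^nat) (w : Rn -> R) :=
  forall g, L2 Omega g ->
    \int[leb]_(x in Omega) (v n x * g x) @[n --> \oo] -->
    \int[leb]_(x in Omega) (w x * g x).

(* Weak-* convergence in L^oo(R^N), as the dual of L^1(R^N). *)
Definition weak_star_cvg (v : (Rn -> R)^nat) (w : Rn -> R) :=
  forall g, g \in Lfun leb 1%E ->
    \int[leb]_x (v n x * g x) @[n --> \oo] --> \int[leb]_x (w x * g x).

(* The kernel called R in the mathematical notation is written K. *)
Definition nonlocal_op (J G K : Rn -> Rn -> R) (A B : set Rn) (u : Rn -> R)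
    (x : Rn) : R :=
    \1_A x * (\int[leb]_(y in A) (J x y * (u y - u x)))
  + \1_A x * (\int[leb]_(y in B) (K x y * (u y - u x)))
  + \1_B x * (\int[leb]_(y in A) (K x y * (u y - u x)))
  + \1_B x * (\int[leb]_(y in B) (G x y * (u y - u x))).

Definition dirichlet_solution (J G K : Rn -> Rn -> R) (Omega A B : set Rn)
    (f u : Rn -> R) : Prop :=
  W_Dir Omega u /\
  {ae leb, forall x, Omega x -> f x = nonlocal_op J G K A B u x}.

Definition limit_system (J G K : Rn -> Rn -> R) (Omega : set Rn)
    (X f uA uB : Rn -> R) : Prop :=
  {ae leb, forall x, Omega x ->
    X x * f x =
      \int[leb]_y (J x y * (X x * uA y - X y * uA x))
      + \int[leb]_y (K x y * (X x * uB y - uA x * (1 - X y)))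
    /\
    (1 - X x) * f x =
      \int[leb]_y (K x y * (uA y * (1 - X x) - uB x * X y))
      + \int[leb]_y (G x y * (uB y * (1 - X x) - uB x * (1 - X y)))}.

Definition limit_pair (J G K : Rn -> Rn -> R) (Omega : set Rn)
    (A B : (set Rn)^nat) (u : (Rn -> R)^nat) (X f uA uB : Rn -> R) : Prop :=
  [/\ L2 Omega uA /\ L2 Omega uB,
      forall x, ~ Omega x -> uA x = 0 /\ uB x = 0,
      weak_cvg_L2 Omega (fun n x => \1_(A n) x * u n x) uA,
      weak_cvg_L2 Omega (fun n x => \1_(B n) x * u n x) uB &
      limit_system J G K Omega X f uA uB].

End nonlocal.

(* Main.v *)
Require Import Defs.
From HB Require Import structures.
From mathcomp Require Import all_boot all_order all_algebra.
From mathcomp Require Import all_classical all_reals all_analysis.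
From mathcomp Require Import measurable_realfun ess_sup_inf.
From mathcomp Require Import ring lra.

(** Let [chi n true] and [chi n false] be the indicators of [A n] and [B n]. Where
    [chi n s] is 1, the Dirichlet equation reads [d n s * u n = g n s - f]: the total
    rate [d n s] is an integral of kernels over [A n] and [B n], and the potential
    [g n s] is the integral of the same kernels against [u n]. Both make sense at every
    point of [Omega], so [phi n s := (g n s - f) / d n s] extends the solution from one
    phase to the whole of [Omega], with [chi n s * u n = chi n s * phi n s]
    ([dirichlet_phase_equation]). The solutions [u n] oscillate with the partitions, but
    the functions [phi n s] converge pointwise and are bounded by [C1 + C2 * |f|].
    Hence [chi n s * u n] is the product of a weakly-* convergent and of a dominated
    pointwise convergent sequence, and it converges weakly
    ([weak_star_mul_dominated_cvg]): [u_A] is [X] times the limit of [phi n true], and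
    [u_B] is [1 - X] times the limit of [phi n false]. The system is the limit of
    [d n s * phi n s = g n s - f], multiplied by [X] or [1 - X] ([phase_limits]). The
    pair is unique because weak limits are.

    It remains to see why [phi n s] converges. On the phase space [bool * R^N] the two
    functions become one, which solves a scalar equation
    [d n * phi n = V (theta n * phi n) - f], where the kernel [V] is symmetric and
    bounded, [theta n] converges weakly-* and [d n] converges pointwise. The proof is
    that of a numerical scheme, stability and consistency.

    Stability: whatever the partition, the mean time after which a jump process with
    these rates leaves [Omega] is bounded. In analytic terms, one explicit function [h] is a
    strict supersolution for all [n] ([uniform_barrier]). Because the kernel is
    symmetric, testing an equation against [theta n * h] bounds the L1 norm of its
    solution by that of its source, uniformly in [n] ([solution_L1_bound]).

    Consistency: the equation of [phi m] becomes the equation of index [n] up to a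
    source which tends to 0 pointwise, since an integral operator turns weak-*
    convergence into pointwise convergence, and which is dominated. By stability
    [theta n * (phi n - phi m)] tends to 0 in L1, hence the potentials approach each other at every
    point ([potential_paired_cvg0]) and the whole sequence satisfies the Cauchy
    criterion ([solutions_pointwise_cvg]). *)

Set Implicit Arguments.
Unset Strict Implicit.
Unset Printing Implicit Defensive.

Import Order.TTheory GRing.Theory Num.Theory.
Import numFieldNormedType.Exports.

Local Open Scope classical_set_scope.
Local Open Scope ring_scope.

(** * Real-valued integrals and sequences *)

Section real_inequalities.
Context {R : realType}.
Implicit Types a b : R.

Lemma ler_norm_1Dsqr a : `|a| <= 1 + a ^+ 2.
Proof.
have := sqr_ge0 a; have := sqr_ge0 (a - 1); have := sqr_ge0 (a + 1).
by rewrite ler_norml !expr2 => *; apply/andP; split; lra.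
Qed.

Lemma sqrrD_le a b : (a + b) ^+ 2 <= 2 * a ^+ 2 + 2 * b ^+ 2.
Proof. by have := sqr_ge0 (a - b); rewrite !expr2; lra. Qed.

End real_inequalities.

Section real_integrals.
Context d (T : measurableType d) (R : realType) (mu : {measure set T -> \bar R}).
Implicit Types f g w : T -> R.

Local Notation integrableR f := (mu.-integrable [set: T] (EFin \o f)).

Lemma integrable_measurable f : integrableR f -> measurable_fun setT f.
Proof. by move=> /measurable_int/measurable_EFinP. Qed.

Lemma integrable_dominated f g :
  measurable_fun setT f -> integrableR g -> (forall x, `|f x| <= g x) ->
  integrableR f.
Proof.
move=> mf ig fg; apply: le_integrable ig => //; first exact/measurable_EFinP.
by move=> x _ /=; rewrite lee_fin (le_trans (fg x))// ler_norm.
Qed.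

Lemma integrableRD f g : integrableR f -> integrableR g ->
  integrableR (fun x => f x + g x).
Proof. by move=> i_f i_g; apply: eq_integrable (integrableD _ i_f i_g). Qed.

Lemma integrableRB f g : integrableR f -> integrableR g ->
  integrableR (fun x => f x - g x).
Proof. by move=> i_f i_g; apply: eq_integrable (integrableB _ i_f i_g). Qed.

Lemma integrable_norm_fun f : integrableR f -> integrableR (fun x => `|f x|).
Proof. exact: integrable_norm. Qed.

Lemma integrable_scale (c : R) f : integrableR f -> integrableR (fun x => c * f x).
Proof. by move=> i_f; apply: eq_integrable (integrableZl measurableT c i_f). Qed.

Lemma integrable_mul_bounded f w (C : R) :
  measurable_fun setT f -> (forall x, `|f x| <= C) -> integrableR w ->
  integrableR (fun x => f x * w x).
Proof.
move=> mf fC iw; apply: (@integrable_dominated _ (fun x => C * `|w x|)).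
- by apply: measurable_funM => //; exact: integrable_measurable.
- exact/integrable_scale/integrable_norm_fun.
- by move=> x; rewrite normrM ler_wpM2r.
Qed.

Lemma le_RintegralT f g : integrableR f -> integrableR g ->
  (forall x, f x <= g x) -> \int[mu]_x f x <= \int[mu]_x g x.
Proof. by move=> *; apply: le_Rintegral. Qed.

Lemma EFin_Rintegral f : integrableR f ->
  (\int[mu]_x f x)%:E = (\int[mu]_x (f x)%:E)%E.
Proof. by move=> i_f; rewrite fineK//; exact: integrable_fin_num. Qed.

Lemma dominated_cvg_Rintegral (f_ : (T -> R)^nat) f g :
  (forall n, measurable_fun setT (f_ n)) ->
  (forall x, f_ n x @[n --> \oo] --> f x) ->
  integrableR g -> (forall n x, `|f_ n x| <= g x) ->
  \int[mu]_x f_ n x @[n --> \oo] --> \int[mu]_x f x.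
Proof.
move=> mf_ f_f ig f_g.
have mf : measurable_fun setT f by exact: measurable_fun_cvg mf_ (fun x _ => f_f x).
have [] := @dominated_convergence _ _ _ mu setT measurableT
  (fun n => EFin \o f_ n) (EFin \o f) (EFin \o g).
- by move=> n; exact/measurable_EFinP.
- exact/measurable_EFinP.
- by apply: aeW => x _; exact: cvg_EFin (nearW _ _) (f_f x).
- exact: ig.
- by apply: aeW => x n _ /=; rewrite lee_fin.
move=> i_f _ cf; apply: fine_cvg; rewrite fineK; first exact: cf.
exact: integrable_fin_num.
Qed.

Lemma dominated_cvg_L1 (f_ : (T -> R)^nat) g :
  (forall n, measurable_fun setT (f_ n)) ->
  (forall x, f_ n x @[n --> \oo] --> 0) ->
  integrableR g -> (forall n x, `|f_ n x| <= g x) ->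
  \int[mu]_x `|f_ n x| @[n --> \oo] --> 0.
Proof.
move=> mf_ f_f ig f_g.
have -> : 0 = \int[mu]_x (cst 0 x : R) by rewrite Rintegral_cst// mul0r.
apply: (@dominated_cvg_Rintegral _ _ g) => //.
- by move=> n; exact: measurableT_comp.
- by move=> x; apply/norm_cvg0P.
- by move=> n x; rewrite normr_id.
Qed.

End real_integrals.

Section sequences.
Context {R : realType}.
Implicit Types u v : nat -> R.

Lemma cvg_subseq (s : nat -> nat) : (forall k, k <= s k)%N -> s k @[k --> \oo] --> \oo.
Proof.
move=> sk A [N _ NA]; exists N => // k /= Nk; apply: NA => /=.
exact: leq_trans Nk (sk k).
Qed.

Lemma cvg_sub_subseq u (s t : nat -> nat) :
  (forall k, k <= s k)%N -> (forall k, k <= t k)%N -> cvgn u ->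
  u (s k) - u (t k) @[k --> \oo] --> 0.
Proof.
move=> hs ht cu; rewrite -(subrr (limn u)); apply: cvgB.
- by apply: (@cvg_comp _ _ _ s u _ _ _ (cvg_subseq hs)); exact: cu.
- by apply: (@cvg_comp _ _ _ t u _ _ _ (cvg_subseq ht)); exact: cu.
Qed.

(** The Cauchy criterion along two index sequences. In this form it only involves
    ordinary sequences, to which dominated convergence applies. *)
Lemma is_cvg_paired_subseq u :
  (forall s t : nat -> nat, (forall k, k <= s k)%N -> (forall k, k <= t k)%N ->
    u (s k) - u (t k) @[k --> \oo] --> 0) ->
  cvgn u.
Proof.
move=> h; apply/cauchy_cvgP/cauchy_ballP => e e0.
apply: contrapT => nC.
have bad k : exists p : nat * nat, [/\ (k <= p.1)%N, (k <= p.2)%N &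
    e <= `|u p.1 - u p.2|].
  apply: contrapT => /forallNP np; apply: nC; near_simpl.
  exists ([set i | (k <= i)%N], [set i | (k <= i)%N]).
    by split; exact: nbhs_infty_ge.
  move=> [i j] /= [ki kj]; rewrite /ball/= ltNge; apply/negP => eij.
  by apply: (np (i, j)).
have [p hp] := choice bad.
have /cvgr0Pnorm_lt/(_ e e0)[N _ /(_ N (leqnn _))] :
    u ((fst \o p) k) - u ((snd \o p) k) @[k --> \oo] --> 0.
  by apply: h => k; have [] := hp k.
by rewrite /= ltNge; have [_ _ ->] := hp N.
Unshelve. all: by end_near. Qed.

Lemma cvg0_le u v : (forall k, `|u k| <= v k) ->
  v k @[k --> \oo] --> 0 -> u k @[k --> \oo] --> 0.
Proof.
move=> uv v0; apply/norm_cvg0P.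
apply: (@squeeze_cvgr _ _ _ _ (cst 0) v _ _ 0) => //; last exact: cvg_cst.
by apply: nearW => k; rewrite normr_ge0 uv.
Qed.

Lemma cvg0D u v : u k @[k --> \oo] --> 0 -> v k @[k --> \oo] --> 0 ->
  u k + v k @[k --> \oo] --> 0.
Proof. by move=> u0 v0; rewrite -[X in _ --> X]addr0; exact: cvgD. Qed.

Lemma cvg0B u v : u k @[k --> \oo] --> 0 -> v k @[k --> \oo] --> 0 ->
  u k - v k @[k --> \oo] --> 0.
Proof. by move=> u0 v0; rewrite -[X in _ --> X]subr0; exact: cvgB. Qed.

Lemma cvg0_scale (a : R) u : u k @[k --> \oo] --> 0 -> a * u k @[k --> \oo] --> 0.
Proof. by move=> u0; rewrite -[X in _ --> X](mulr0 a); exact: cvgMr. Qed.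

End sequences.

(** * Operators with a symmetric bounded kernel *)

Lemma measurable_Rintegral_param d1 d2 (T1 : measurableType d1)
    (T2 : measurableType d2) (R : realType)
    (mu : {sigma_finite_measure set T2 -> \bar R}) (F : T1 * T2 -> R) :
  measurable_fun setT F -> measurable_fun setT (fun x => \int[mu]_y F (x, y)).
Proof.
move=> /measurable_EFinP mF.
apply: (@measurableT_comp _ _ _ _ _ _ fine) => //.
have -> : (fun x => \int[mu]_y (F (x, y))%:E)%E =
    (fubini_F mu (EFin \o F)^\+ \- fubini_F mu (EFin \o F)^\-)%E.
  apply/funext => x; rewrite integralE /fubini_F.
  by congr (_ - _)%E; apply: eq_integral => y _; rewrite ?funeposE ?funenegE.
by apply: emeasurable_funB; apply: measurable_fun_fubini_tonelli_F => //;
  [exact: measurable_funepos|exact: measurable_funeneg].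
Qed.

Lemma measurable_fun_inv_nonneg d (T : measurableType d) (R : realType) (b : T -> R) :
  measurable_fun setT b -> (forall x, 0 <= b x) ->
  measurable_fun setT (fun x => (b x)^-1).
Proof.
move=> mb b0; have -> : (fun x => (b x)^-1) = (fun r => r `^ (-1)) \o b.
  (* The convention 0 ^-1 = 0 makes the two powers agree at 0 as well. *)
  by apply/funext => x /=; rewrite powR_inv1.
by apply: measurableT_comp mb; exact: measurable_powR.
Qed.

Section kernel_operator.
Context d (Z : measurableType d) (R : realType)
  (mu : {finite_measure set Z -> \bar R}).
Implicit Types (V : Z -> Z -> R) (w h v r theta : Z -> R).

Local Notation integrableR f := (mu.-integrable [set: _] (EFin \o f)).

Definition kernel_op V w z := \int[mu]_y (V z y * w y).

Definition sym_bounded_kernel V (C : R) : Prop :=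
  [/\ measurable_fun setT (fun p : Z * Z => V p.1 p.2),
      forall z y, 0 <= V z y <= C & forall z y, V z y = V y z].

Context V (C : R) (hV : sym_bounded_kernel V C).

Let mV : measurable_fun setT (fun p : Z * Z => V p.1 p.2).
Proof. by case: hV. Qed.

Let V_ge0 z y : 0 <= V z y.
Proof. by case: hV => _ /(_ z y)/andP[]. Qed.

Let V_le z y : V z y <= C.
Proof. by case: hV => _ /(_ z y)/andP[]. Qed.

Let V_norm z y : `|V z y| <= C.
Proof. by rewrite ger0_norm. Qed.

Lemma measurable_kernel_section z : measurable_fun setT (V z).
Proof.
exact: (measurableT_comp mV (pair1_measurable z)).
Qed.

Lemma integrable_kernel w z : integrableR w -> integrableR (fun y => V z y * w y).
Proof.
by move=> iw; apply: integrable_mul_bounded iw => //; exact: measurable_kernel_section.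
Qed.

Lemma kernel_opD w v z : integrableR w -> integrableR v ->
  kernel_op V (fun y => w y + v y) z = kernel_op V w z + kernel_op V v z.
Proof.
move=> iw iv; rewrite /kernel_op -RintegralD//; [|exact: integrable_kernel..].
by apply: eq_Rintegral => y _; rewrite mulrDr.
Qed.

Lemma kernel_opB w v z : integrableR w -> integrableR v ->
  kernel_op V (fun y => w y - v y) z = kernel_op V w z - kernel_op V v z.
Proof.
move=> iw iv; rewrite /kernel_op -RintegralB//; [|exact: integrable_kernel..].
by apply: eq_Rintegral => y _; rewrite mulrBr.
Qed.

Lemma kernel_op_norm w z : integrableR w ->
  `|kernel_op V w z| <= kernel_op V (fun y => `|w y|) z.
Proof.
move=> iw; apply: (le_trans (le_normr_Rintegral _ _)) => //.
  exact: integrable_kernel.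
rewrite le_eqVlt; apply/orP; left; apply/eqP.
by apply: eq_Rintegral => y _; rewrite normrM (ger0_norm (V_ge0 _ _)).
Qed.

Lemma kernel_op_bound w z : integrableR w ->
  `|kernel_op V w z| <= C * \int[mu]_y `|w y|.
Proof.
move=> iw; apply: (le_trans (kernel_op_norm _ iw)).
have inw := integrable_norm_fun iw.
rewrite -RintegralZl//; apply: (@le_RintegralT _ _ _ mu) => [||y].
- exact: integrable_kernel.
- exact/integrable_scale.
- by rewrite ler_wpM2r.
Qed.

Lemma measurable_kernel_op w : measurable_fun setT w ->
  measurable_fun setT (kernel_op V w).
Proof.
move=> mw; apply: (@measurable_Rintegral_param _ _ _ _ _ mu
  (fun p : Z * Z => V p.1 p.2 * w p.2)).
by apply: measurable_funM => //; exact: measurableT_comp mw _.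
Qed.

Lemma integrable_mul_kernel_op w1 w2 : integrableR w1 -> integrableR w2 ->
  integrableR (fun z => kernel_op V w2 z * w1 z).
Proof.
move=> i1 i2; apply: integrable_mul_bounded i1 => [|z].
  exact/measurable_kernel_op/(integrable_measurable i2).
exact: kernel_op_bound.
Qed.

(** The symmetry of the kernel and Fubini's theorem; boundedness of the kernel
    makes the double integral absolutely convergent. *)
Lemma kernel_op_sym w1 w2 : integrableR w1 -> integrableR w2 ->
  \int[mu]_z (kernel_op V w2 z * w1 z) = \int[mu]_z (kernel_op V w1 z * w2 z).
Proof.
move=> i1 i2; pose F (p : Z * Z) := (V p.1 p.2 * w2 p.2 * w1 p.1)%:E.
have m1 := integrable_measurable i1; have m2 := integrable_measurable i2.
have mF : measurable_fun setT F.
  apply/measurable_EFinP/measurable_funM; last exact: measurableT_comp m1 _.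
  by apply: measurable_funM => //; exact: measurableT_comp m2 _.
have iF : (mu \x mu)%E.-integrable setT F.
  apply: ((@integrable12ltyP _ _ _ _ _ mu mu _ mF).2).
  have -> : (fun z => \int[mu]_y `|F (z, y)|)%E =
      (fun z => (kernel_op V (fun y => `|w2 y|) z * `|w1 z|)%:E).
    apply/funext => z.
    under eq_integral do rewrite /F/= !normrM (ger0_norm (V_ge0 _ _)) EFinM.
    rewrite integralZr//; last exact/integrable_kernel/integrable_norm_fun.
    by rewrite EFinM EFin_Rintegral//; exact/integrable_kernel/integrable_norm_fun.
  apply: integrable_lty => //; apply: integrable_mul_kernel_op.
    exact: integrable_norm_fun.
  exact: integrable_norm_fun.
have H := Fubini iF.
apply: EFin_inj; rewrite !EFin_Rintegral; [|exact: integrable_mul_kernel_op..].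
transitivity (\int[mu]_z \int[mu]_y F (z, y))%E.
  apply: eq_integral => z _; under [RHS]eq_integral do rewrite /F/= EFinM.
  rewrite integralZr//; last exact: integrable_kernel.
  by rewrite EFinM EFin_Rintegral//; exact: integrable_kernel.
rewrite H; apply: eq_integral => y _.
have -> : (\int[mu]_z F (z, y) = \int[mu]_z ((V y z * w1 z)%:E * (w2 y)%:E))%E.
  apply: eq_integral => z _; rewrite /F/= -EFinM; congr EFin.
  by case: hV => _ _ /(_ z y) ->; rewrite mulrAC.
rewrite integralZr//; last exact: integrable_kernel.
by rewrite EFinM EFin_Rintegral//; exact: integrable_kernel.
Qed.

(** Kato's inequality in integrated form. The subsolution [`|v|] is tested against
    the strict supersolution [theta * h]; self-adjointness moves the operator from
    [`|v|] to [h], where it is at most [dn * h - c]. The constants depend only on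
    [h] and [c], so the bound is uniform in [theta] and [dn]. *)
Lemma supersolution_L1_bound theta dn h v r (c M : R) :
  measurable_fun setT theta -> (forall z, 0 <= theta z <= 1) ->
  measurable_fun setT h -> (forall z, 0 <= h z <= M) ->
  (forall z, kernel_op V (fun y => theta y * h y) z + c <= dn z * h z) ->
  integrableR v -> integrableR r ->
  (forall z, dn z * `|v z| <= kernel_op V (fun y => theta y * `|v y|) z + `|r z|) ->
  c * \int[mu]_z (theta z * `|v z|) <= M * \int[mu]_z `|r z|.
Proof.
move=> mtheta theta01 mh h0M hsup iv ir hv.
have theta_norm z : `|theta z| <= 1.
  by have /andP[t0 t1] := theta01 z; rewrite ger0_norm.
have h_norm z : `|h z| <= M by have /andP[t0 t1] := h0M z; rewrite ger0_norm.
pose w z := theta z * `|v z|; pose k z := theta z * h z.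
have iw : integrableR w.
  apply: integrable_mul_bounded => //; exact: integrable_norm_fun.
have mk : measurable_fun setT k by exact: measurable_funM.
have kM z : `|k z| <= M.
  by rewrite normrM -[leRHS]mul1r ler_pM.
have ik : integrableR k.
  apply: (@integrable_dominated _ _ _ _ _ (cst M)) => //.
  exact: finite_measure_integrable_cst.
have i_kw := integrable_mul_kernel_op ik iw.
have i_wk := integrable_mul_kernel_op iw ik.
have i_kr : integrableR (fun z => k z * `|r z|).
  by apply: (@integrable_mul_bounded _ _ _ _ _ _ M) => //; exact: integrable_norm_fun.
have icw := integrable_scale c iw.
have : \int[mu]_z (c * w z + kernel_op V k z * w z) <=
       \int[mu]_z (kernel_op V w z * k z + k z * `|r z|).
  apply: le_RintegralT; [exact: integrableRD..|move=> z].
  have /andP[t0 _] := theta01 z; have /andP[h0 _] := h0M z.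
  apply: (@le_trans _ _ (k z * (dn z * `|v z|))).
    rewrite -mulrDl addrC (le_trans (ler_wpM2r _ (hsup z)))//.
      by rewrite mulr_ge0.
    by rewrite /w /k; lra.
  by rewrite [kernel_op _ _ _ * _]mulrC -mulrDr ler_wpM2l// mulr_ge0.
rewrite !RintegralD// RintegralZl// (kernel_op_sym iw ik) addrC lerD2l.
move=> /le_trans; apply; rewrite -RintegralZl//; last exact: integrable_norm_fun.
apply: le_RintegralT => //; first exact/integrable_scale/integrable_norm_fun.
by move=> z; rewrite ler_wpM2r// (le_trans (ler_norm _)).
Qed.

Lemma solution_L1_bound theta dn h v r (c M : R) :
  measurable_fun setT theta -> (forall z, 0 <= theta z <= 1) ->
  measurable_fun setT h -> (forall z, 0 <= h z <= M) ->
  (forall z, 0 <= dn z) ->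
  (forall z, kernel_op V (fun y => theta y * h y) z + c <= dn z * h z) ->
  integrableR v -> integrableR r ->
  (forall z, dn z * v z = kernel_op V (fun y => theta y * v y) z + r z) ->
  c * \int[mu]_z (theta z * `|v z|) <= M * \int[mu]_z `|r z|.
Proof.
move=> mtheta theta01 mh h0M dn0 hsup iv ir v_eq.
have theta0 z : 0 <= theta z by have /andP[] := theta01 z.
have itv : integrableR (fun z => theta z * v z).
  apply: (@integrable_mul_bounded _ _ _ _ _ _ 1) => // z.
  by rewrite ger0_norm//; have /andP[] := theta01 z.
apply: (supersolution_L1_bound mtheta theta01 mh h0M hsup) => // z.
rewrite -[dn z](ger0_norm (dn0 z)) -normrM v_eq (le_trans (ler_normD _ _))// lerD2r.
rewrite (le_trans (kernel_op_norm _ itv))// le_eqVlt; apply/orP; left; apply/eqP.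
by apply: eq_Rintegral => y _; rewrite normrM (ger0_norm (theta0 y)).
Qed.

End kernel_operator.

(** * Pointwise convergence of the solutions *)

(** On a finite measure space, [phi n] solves
    [dn n * phi n = V (theta n * phi n) - f], where the densities [theta n] converge
    weakly-* and the rates [dn n] pointwise, and where one strict supersolution [h]
    serves all [n]. *)
Section solutions_of_kernel_equations.
Context d (Z : measurableType d) (R : realType)
  (mu : {finite_measure set Z -> \bar R}).

Local Notation integrableR f := (mu.-integrable [set: _] (EFin \o f)).

Context (V : Z -> Z -> R) (C : R) (hV : sym_bounded_kernel V C)
  (theta dn phi : (Z -> R)^nat) (dlim f h : Z -> R) (c kappa L M : R).

Context (mtheta : forall n, measurable_fun setT (theta n))
  (theta01 : forall n z, 0 <= theta n z <= 1)
  (theta_cvg : forall w, integrableR w -> cvgn (fun n => \int[mu]_z (theta n z * w z)))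
  (mdn : forall n, measurable_fun setT (dn n))
  (kappa_gt0 : 0 < kappa) (dn_ge : forall n z, kappa <= dn n z)
  (dn_le : forall n z, dn n z <= L)
  (dn_cvg : forall z, dn n z @[n --> \oo] --> dlim z)
  (mh : measurable_fun setT h) (h0M : forall z, 0 <= h z <= M) (c_gt0 : 0 < c)
  (h_super : forall n z,
    kernel_op mu V (fun y => theta n y * h y) z + c <= dn n z * h z)
  (i_f : integrableR f) (i_phi : forall n, integrableR (phi n))
  (phi_eq : forall n z,
    dn n z * phi n z = kernel_op mu V (fun y => theta n y * phi n y) z - f z).

Let theta_ge0 n z : 0 <= theta n z. Proof. by have /andP[] := theta01 n z. Qed.

Let theta_norm n z : `|theta n z| <= 1.
Proof. by rewrite ger0_norm//; have /andP[] := theta01 n z. Qed.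

Let dn_gt0 n z : 0 < dn n z. Proof. exact: lt_le_trans kappa_gt0 (dn_ge n z). Qed.

Let dlim_ge z : kappa <= dlim z.
Proof.
have <- := cvg_lim (@Rhausdorff R) (@dn_cvg z); apply: limr_ge.
  by apply/cvg_ex; exists (dlim z); exact: dn_cvg.
exact: nearW.
Qed.

Let dlim_gt0 z : 0 < dlim z. Proof. exact: lt_le_trans kappa_gt0 (dlim_ge z). Qed.

Let i_thetaM n w : integrableR w -> integrableR (fun z => theta n z * w z).
Proof. exact: integrable_mul_bounded. Qed.

Let i_thetaphi n : integrableR (fun z => theta n z * phi n z).
Proof. exact: i_thetaM. Qed.

Let g n : Z -> R := kernel_op mu V (fun y => theta n y * phi n y).

Let phi_L1 n : \int[mu]_z (theta n z * `|phi n z|) <= c^-1 * (M * \int[mu]_z `|f z|).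
Proof.
rewrite ler_pdivlMl//.
under [X in _ <= M * X]eq_Rintegral do rewrite -normrN.
apply: (solution_L1_bound hV (mtheta n) (theta01 n) mh h0M _ (h_super n)) => //.
- by move=> z; exact: ltW.
- have := integrable_scale (-1) i_f.
  by apply: eq_integrable => // z _ /=; rewrite mulN1r.
Qed.

Let G := C * (c^-1 * (M * \int[mu]_z `|f z|)).

Let g_bound n z : `|g n z| <= G.
Proof.
have C0 : 0 <= C by case: hV => _ /(_ z z) /andP[V0 /(le_trans V0)].
apply: (le_trans (kernel_op_bound hV _ (i_thetaphi n))).
rewrite ler_wpM2l// (le_trans _ (phi_L1 n))// le_eqVlt; apply/orP; left.
apply/eqP; apply: eq_Rintegral => y _.
by rewrite normrM (ger0_norm (theta_ge0 n y)).
Qed.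

Let phiE n z : phi n z = (g n z - f z) / dn n z.
Proof. by rewrite -phi_eq mulrAC divff ?mul1r// gt_eqF. Qed.

(** The potentials [g n] are bounded uniformly in [n], so the solutions have a common
    integrable bound. *)
Let F z := kappa^-1 * (G + `|f z|).

Let phi_bound n z : `|phi n z| <= F z.
Proof.
rewrite phiE normrM normfV mulrC (ger0_norm (ltW (dn_gt0 n z))).
apply: ler_pM => //.
- by rewrite invr_ge0 ltW.
- by rewrite lef_pV2// posrE.
- by rewrite (le_trans (ler_normB _ _))// lerD2r.
Qed.

Let F_ge0 z : 0 <= F z. Proof. exact: le_trans (phi_bound 0 z). Qed.

Let i_cst (a : R) : integrableR (cst a).
Proof. exact: finite_measure_integrable_cst. Qed.

Let i_F : integrableR F.
Proof.
apply: integrable_scale; apply: integrableRD; first exact: i_cst.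
exact: integrable_norm_fun.
Qed.

Let mV z : measurable_fun setT (V z). Proof. exact: measurable_kernel_section hV z. Qed.

Let C_ge0 (z : Z) : 0 <= C.
Proof. by case: hV => _ /(_ z z) /andP[V0 /(le_trans V0)]. Qed.

Let V_norm z y : `|V z y| <= C.
Proof. by case: hV => _ /(_ z y)/andP[V0 VC] _; rewrite ger0_norm. Qed.

Let mphi n : measurable_fun setT (phi n). Proof. exact: integrable_measurable. Qed.
Let mf : measurable_fun setT f. Proof. exact: integrable_measurable i_f. Qed.
Let mg n : measurable_fun setT (g n).
Proof. exact/(measurable_kernel_op mu hV)/(integrable_measurable (i_thetaphi n)). Qed.

Let mdlim : measurable_fun setT dlim.
Proof. by apply: measurable_fun_cvg mdn _ => z _; exact: dn_cvg. Qed.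

Let measurable_pos_inv (b : Z -> R) : measurable_fun setT b -> (forall z, 0 < b z) ->
  measurable_fun setT (fun z => (b z)^-1).
Proof. by move=> mb b0; apply: measurable_fun_inv_nonneg => // z; exact: ltW. Qed.

Let inv_bound b : kappa <= b -> `|b^-1| <= kappa^-1.
Proof.
move=> kb; have b0 := lt_le_trans kappa_gt0 kb.
rewrite ger0_norm; last by rewrite invr_ge0 ltW.
by rewrite lef_pV2// posrE.
Qed.

Section paired_subsequences.
Context (s t : nat -> nat) (hs : forall k, (k <= s k)%N) (ht : forall k, (k <= t k)%N).

Let delta k z := theta (s k) z - theta (t k) z.

Let mdelta k : measurable_fun setT (delta k).
Proof. exact: measurable_funB. Qed.

Let delta_norm k z : `|delta k z| <= 2.
Proof. by rewrite (le_trans (ler_normB _ _))// -[leRHS]/(1 + 1) lerD. Qed.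

Let i_delta k w : integrableR w -> integrableR (fun z => delta k z * w z).
Proof. exact: integrable_mul_bounded. Qed.

Let delta_cvg0 w : integrableR w ->
  \int[mu]_z (delta k z * w z) @[k --> \oo] --> 0.
Proof.
move=> iw; have := cvg_sub_subseq hs ht (theta_cvg iw).
apply: cvg_trans; apply: near_eq_cvg; apply: nearW => k /=.
rewrite -RintegralB//; [|exact: i_thetaM..].
by apply: eq_Rintegral => z _; rewrite -mulrBl.
Qed.

Let kernel_delta_cvg0 w z : integrableR w ->
  kernel_op mu V (fun y => delta k y * w y) z @[k --> \oo] --> 0.
Proof.
move=> iw; have := delta_cvg0 (integrable_kernel hV z iw).
by under eq_fun do under eq_Rintegral do rewrite mulrCA.
Qed.

(** The consistency error made when [theta (s k)] replaces [theta (t k)] in the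
    equation of [phi (t k)]. *)
Let e k : Z -> R := kernel_op mu V (fun y => delta k y * phi (t k) y).

(** Here [theta (s k) - theta (t k)], which tends to 0 only weakly-*, is multiplied by
    the varying functions [phi (t k) = (g (t k) - f) / dn (t k)]. The rates converge
    pointwise, so [dlim] may replace them, and [f / dlim] is a fixed integrable
    function. In the remaining term the potential [g (t k)] is the image of a function
    bounded by [F]; self-adjointness moves the operator onto
    [(theta (s k) - theta (t k)) * V z / dlim], whose image tends to 0 pointwise. *)
Let e_cvg0 z : e k z @[k --> \oo] --> 0.
Proof.
pose a y := V z y * (dlim y)^-1.
have ma : measurable_fun setT a.
  by apply: measurable_funM => //; exact: measurable_pos_inv.
have a_norm y : `|a y| <= C * kappa^-1 by rewrite normrM ler_pM// inv_bound.
have ia : integrableR a.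
  exact: integrable_dominated ma (i_cst (C * kappa^-1)) _.
pose e1 k y := V z y * (delta k y * ((g (t k) y - f y) * ((dn (t k) y)^-1 - (dlim y)^-1))).
pose e2 k y := kernel_op mu V (fun x => theta (t k) x * phi (t k) x) y * (delta k y * a y).
pose e3 k y := delta k y * (a y * f y).
have me1 k : measurable_fun setT (e1 k).
  apply: measurable_funM => //; apply: measurable_funM => //.
  apply: measurable_funM; first exact: measurable_funB.
  by apply: measurable_funB; exact: measurable_pos_inv.
have e1_bound k y : `|e1 k y| <= C * (2 * ((G + `|f y|) * (kappa^-1 + kappa^-1))).
  rewrite /e1 !normrM ler_pM// ler_pM// ler_pM//.
    by rewrite (le_trans (ler_normB _ _))// lerD2r.
  by rewrite (le_trans (ler_normB _ _))// lerD// inv_bound.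
have iE1 : integrableR (fun y => C * (2 * ((G + `|f y|) * (kappa^-1 + kappa^-1)))).
  do 2 apply: integrable_scale.
  under [X in integrable _ _ X]eq_fun do rewrite /= [X in X%:E]mulrC.
  apply: integrable_scale; apply: integrableRD; first exact: i_cst.
  exact: integrable_norm_fun.
have ie1 k : integrableR (e1 k) by exact: integrable_dominated iE1 _.
have i_da k : integrableR (fun y => delta k y * a y) by exact: i_delta.
have ie2 k : integrableR (e2 k).
  by apply: (integrable_mul_kernel_op hV).
have iaf : integrableR (fun y => a y * f y).
  exact: (integrable_mul_bounded (C := C * kappa^-1)).
have ie3 k : integrableR (e3 k) by exact: i_delta.
have -> : e ^~ z = (fun k => \int[mu]_y e1 k y + \int[mu]_y e2 k y - \int[mu]_y e3 k y).
  apply/funext => k; rewrite -RintegralD// -RintegralB//; last exact: integrableRD.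
  apply: eq_Rintegral => y _; rewrite /e1 /e2 /e3 /a phiE -/(g _ _); ring.
have c1 : \int[mu]_y e1 k y @[k --> \oo] --> 0.
  have c1' : \int[mu]_y `|e1 k y| @[k --> \oo] --> 0.
    apply: dominated_cvg_L1 iE1 e1_bound => // y.
    have cinv : (dn (t k) y)^-1 - (dlim y)^-1 @[k --> \oo] --> 0.
      rewrite -(subrr (dlim y)^-1); apply: cvgB; last exact: cvg_cst.
      apply: cvgV; first by rewrite gt_eqF.
      by apply: (@cvg_comp _ _ _ t (dn ^~ y) _ _ _ (cvg_subseq ht)); exact: dn_cvg.
    apply: (@cvg0_le R (fun n => e1 n y) (fun k => C * (2 * ((G + `|f y|) *
        `|(dn (t k) y)^-1 - (dlim y)^-1|)))) => [k|].
      rewrite /e1 !normrM ler_pM// ler_pM// ler_wpM2r//.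
      by rewrite (le_trans (ler_normB _ _))// lerD2r.
    by do 3 apply: cvg0_scale; exact/norm_cvg0P.
  apply: (@cvg0_le R (fun k => \int[mu]_y e1 k y) _ _ c1') => k.
  exact: le_normr_Rintegral.
have c2 : \int[mu]_y e2 k y @[k --> \oo] --> 0.
  have -> : (fun k => \int[mu]_y e2 k y) = (fun k => \int[mu]_y
      (kernel_op mu V (fun x => delta k x * a x) y * (theta (t k) y * phi (t k) y))).
    by apply/funext => k; rewrite (kernel_op_sym hV).
  have -> : 0 = \int[mu]_y (cst 0 y : R) by rewrite Rintegral_cst// mul0r.
  apply: (@dominated_cvg_Rintegral _ _ _ _ _ _
    (fun y => C * (2 * \int[mu]_y `|a y|) * F y)).
  - move=> k; apply: measurable_funM; last exact: integrable_measurable.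
    exact/(measurable_kernel_op mu hV)/(integrable_measurable (i_da k)).
  - move=> y; apply: (@cvg0_le R (fun k => kernel_op mu V (fun x => delta k x * a x) y *
        (theta (t k) y * phi (t k) y)) (fun k =>
        F y * `|kernel_op mu V (fun x => delta k x * a x) y|)) => [k|].
      rewrite normrM mulrC ler_wpM2r// normrM.
      by rewrite -[leRHS]mul1r ler_pM.
    by apply: cvg0_scale; apply/norm_cvg0P; exact: kernel_delta_cvg0.
  - exact: integrable_scale.
  move=> k y; rewrite normrM ler_pM//; last first.
    by rewrite normrM -[leRHS]mul1r ler_pM.
  rewrite (le_trans (kernel_op_bound hV _ (i_da k)))// ler_wpM2l ?(C_ge0 y)//.
  rewrite -RintegralZl//; last exact: integrable_norm_fun.
  apply: le_RintegralT; first exact: integrable_norm_fun.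
    exact/integrable_scale/integrable_norm_fun.
  by move=> x; rewrite normrM ler_wpM2r.
exact: cvg0B (cvg0D c1 c2) (delta_cvg0 iaf).
Qed.

(** The difference [p] of two solutions solves the equation with density
    [theta (s k)] and a source [r] that tends to 0 in L1, so [solution_L1_bound]
    applies to it. *)
Lemma potential_paired_cvg0 z : g (s k) z - g (t k) z @[k --> \oo] --> 0.
Proof.
pose p k y := phi (s k) y - phi (t k) y.
pose r k y := e k y - (dn (s k) y - dn (t k) y) * phi (t k) y.
have ip k : integrableR (p k) by exact: integrableRB.
have i_tp k : integrableR (fun y => theta (s k) y * p k y) by exact: i_thetaM.
have i_e' k : integrableR (fun y => delta k y * phi (t k) y) by exact: i_delta.
have me k : measurable_fun setT (e k).
  exact/(measurable_kernel_op mu hV)/(integrable_measurable (i_e' k)).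
have gE k y : g (s k) y - g (t k) y =
    kernel_op mu V (fun x => theta (s k) x * p k x) y + e k y.
  rewrite /g /e -(kernel_opB hV)// -(kernel_opD hV)//; congr (kernel_op _ _ _ _).
  by apply/funext => x; rewrite /p /delta; ring.
have e_bound k y : `|e k y| <= C * (2 * \int[mu]_x F x).
  rewrite (le_trans (kernel_op_bound hV _ (i_e' k)))// ler_wpM2l ?(C_ge0 y)//.
  rewrite -RintegralZl//; apply: le_RintegralT.
  - exact: integrable_norm_fun.
  - exact: integrable_scale.
  - by move=> x; rewrite normrM ler_pM.
have i_cstZ (a : R) : integrableR (fun=> a) by exact: i_cst.
have ie k : integrableR (e k).
  by apply: integrable_dominated (me k) (i_cstZ (C * (2 * \int[mu]_x F x))) _ => y.
pose q k y := (dn (s k) y - dn (t k) y) * phi (t k) y.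
have mq k : measurable_fun setT (q k).
  by apply: measurable_funM => //; exact: measurable_funB.
have q_cvg0 y : q k y @[k --> \oo] --> 0.
  apply: (@cvg0_le R _ (fun k => F y * `|dn (s k) y - dn (t k) y|)) => [k|].
    by rewrite normrM mulrC ler_wpM2r.
  apply: cvg0_scale; apply/norm_cvg0P.
  apply: (@cvg_sub_subseq _ (dn ^~ y) s t hs ht).
  by apply/cvg_ex; exists (dlim y); exact: dn_cvg.
have q_bound k y : `|q k y| <= L * F y.
  rewrite normrM ler_pM// ler_norml.
  have := dn_le (s k) y; have := dn_le (t k) y.
  by have := dn_gt0 (s k) y; have := dn_gt0 (t k) y; lra.
have iq k : integrableR (q k).
  by apply: integrable_dominated (mq k) (integrable_scale L i_F) _ => y.
have ir k : integrableR (r k) by exact: integrableRB (ie k) (iq k).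
have pE k y : dn (s k) y * p k y =
    kernel_op mu V (fun x => theta (s k) x * p k x) y + r k y.
  transitivity (dn (s k) y * phi (s k) y - dn (t k) y * phi (t k) y - q k y).
    by rewrite /p /q; ring.
  by rewrite !phi_eq -!/(g _ _) /r addrA -gE /q; ring.
have p_L1 k : \int[mu]_y (theta (s k) y * `|p k y|) <=
    c^-1 * (M * \int[mu]_y `|r k y|).
  rewrite ler_pdivlMl//.
  apply: (solution_L1_bound hV (mtheta (s k)) (theta01 _) mh h0M _ (h_super _)) => //.
  by move=> y; exact: ltW.
have r_L1 : \int[mu]_y `|r k y| @[k --> \oo] --> 0.
  apply: (@dominated_cvg_L1 _ _ _ _ _ (fun y => C * (2 * \int[mu]_x F x) + L * F y)).
  - by move=> k; exact: integrable_measurable.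
  - by move=> y; exact: (cvg0B (e_cvg0 y) (q_cvg0 y)).
  - exact: integrableRD (i_cstZ _) (integrable_scale L i_F).
  - move=> k y; rewrite /r (le_trans (ler_normB _ _))//.
    by apply: lerD; [exact: e_bound|exact: q_bound].
apply: (@cvg0_le R _ (fun k => C * (c^-1 * (M * \int[mu]_y `|r k y|)) + `|e k z|)).
  move=> k; rewrite gE (le_trans (ler_normD _ _))// lerD2r.
  rewrite (le_trans (kernel_op_bound hV _ (i_tp k)))// ler_wpM2l ?(C_ge0 z)//.
  rewrite (le_trans _ (p_L1 k))// le_eqVlt; apply/orP; left.
  apply/eqP; apply: eq_Rintegral => y _.
  by rewrite normrM (ger0_norm (theta_ge0 _ y)).
apply: cvg0D; last by apply/norm_cvg0P; exact: e_cvg0.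
by do 3 apply: cvg0_scale.
Qed.

End paired_subsequences.

(** The potentials along any two index sequences approach each other, so the whole
    sequence converges. The bound makes every passage to the limit below an
    application of dominated convergence. *)
Lemma solutions_pointwise_cvg :
  (forall z, cvgn (phi ^~ z)) /\
  exists C1 C2, [/\ 0 <= C1, 0 <= C2 & forall n z, `|phi n z| <= C1 + C2 * `|f z|].
Proof.
split=> [z|].
  have cg : cvgn (g ^~ z).
    by apply: is_cvg_paired_subseq => s t hs ht; exact: (potential_paired_cvg0 hs ht).
  have -> : phi ^~ z = (fun n => (g n z - f z) * (dn n z)^-1).
    by apply/funext => n; exact: phiE.
  apply: is_cvgM; first by apply: is_cvgB => //; exact: is_cvg_cst.
  apply: is_cvgV; last by apply/cvg_ex; exists (dlim z); exact: dn_cvg.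
  by have -> := cvg_lim (@Rhausdorff R) (@dn_cvg z); rewrite gt_eqF.
have [[z _]|/forallNP nz] := pselect (exists z : Z, True); last first.
  by exists 0, 0; split => // n z; case: (nz z).
exists (kappa^-1 * G), kappa^-1; split.
- by rewrite mulr_ge0// ?invr_ge0 ?(ltW kappa_gt0)// (le_trans _ (g_bound 0 z)).
- by rewrite invr_ge0 ltW.
- by move=> n y; rewrite -mulrDr.
Qed.

End solutions_of_kernel_equations.

(** * Kernels on the Euclidean space *)

Section lebesgue_rV_facts.
Context {R : realType} {N : nat}.
Local Notation Rn := 'rV[R]_N.
Local Notation leb := (@lebesgue_rV R N).
Implicit Types (v x y : Rn) (Omega : set Rn) (V : Rn -> Rn -> R).

Lemma rational_ball v (e : R) : 0 < e ->
  exists q : 'rV[rat]_N, ball (map_mx ratr q : Rn) e v.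
Proof.
move=> e0.
have qP i : exists q : rat, `|ratr q - v ord0 i| < e.
  have /rat_in_itvoo[q] : v ord0 i - e < v ord0 i + e.
    by rewrite ltrBlDr -addrA ltrDl addr_gt0.
  by rewrite in_itv/= => qv; exists q; rewrite ltr_distl.
have [q qv] := choice qP.
exists (\row_i q i); split => // i j; rewrite ord1 !mxE.
exact: qv.
Qed.

(** The sigma-algebra of a product is generated by rectangles; an open set of
    the product is a countable union of products of rational balls. *)
Lemma open_measurable_prod (U : set (Rn * Rn)) : open U -> measurable U.
Proof.
move=> oU.
pose box (p : 'rV[rat]_N * 'rV[rat]_N * nat) : set (Rn * Rn) :=
  ball (map_mx ratr p.1.1 : Rn) p.2.+1%:R^-1 `*`
  ball (map_mx ratr p.1.2 : Rn) p.2.+1%:R^-1.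
have -> : U = \bigcup_(p in [set p | box p `<=` U]) box p.
  apply/seteqP; split => [[v w] Uvw|vw [p pU]]; last exact: pU.
  have /nbhs_ballP[e /= e0 veU] := open_nbhs_nbhs (conj oU Uvw).
  have e20 : 0 < e / 2 by rewrite divr_gt0.
  pose k := Num.truncn (e / 2)^-1.
  have k0 : 0 < k.+1%:R^-1 :> R by rewrite invr_gt0.
  have ke : k.+1%:R^-1 < e / 2.
    by rewrite -[ltRHS]invrK ltf_pV2 ?posrE ?invr_gt0// truncnS_gt.
  have close (a b c : Rn) : ball a k.+1%:R^-1 b -> ball a k.+1%:R^-1 c -> ball b e c.
    move=> /ball_sym ab ac; apply: le_ball (ball_triangle ab ac).
    by rewrite [leRHS]splitr lerD// ltW.
  have [q1 hq1] := rational_ball v k0.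
  have [q2 hq2] := rational_ball w k0.
  exists (q1, q2, k) => //= -[v' w'] [/= hv hw].
  by apply: veU; split => /=; [exact: close hq1 hv|exact: close hq2 hw].
rewrite bigcup_mkcond; apply: countable_bigcupT_measurable => // p.
case: ifPn => // _.
by apply: measurableX; apply: open_measurable_rV; exact: ball_open.
Qed.

Lemma continuous_kernel_measurable V : continuous (fun p : Rn * Rn => V p.1 p.2) ->
  measurable_fun [set: Rn * Rn] (fun p : Rn * Rn => V p.1 p.2).
Proof.
move=> /continuousP cV; apply: (measurability _ (RGenOpens.measurableE R)).
move=> _ [_ [a [b ->] <-]]; rewrite setTI; apply: open_measurable_prod.
exact/cV/interval_open.
Qed.

Lemma continuous_rV_measurable (g : Rn -> R) : continuous g -> measurable_fun setT g.
Proof.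
move=> /continuousP cg; apply: (measurability _ (RGenOpens.measurableE R)).
move=> _ [_ [a [b ->] <-]]; rewrite setTI; apply: open_measurable_rV.
exact/cg/interval_open.
Qed.

Lemma bounded_set_norm_le (T : pseudoMetricNormedZmodType R) (A : set T) :
  bounded_set A -> exists M, forall t, A t -> `|t| <= M.
Proof. by move=> bA; have [M AM] := @filter_ex _ (pinfty_nbhs R) _ _ bA; exists M. Qed.

Lemma bounded_sub_compact Omega : bounded_set Omega ->
  exists2 K : set Rn, compact K & Omega `<=` K.
Proof.
move=> /bounded_set_norm_le[M OM]; exists [set x | `|x| <= M]; last exact: OM.
apply: bounded_closed_compact.
  exists M; split; first exact: num_real.
  by move=> a Ma x /= /le_trans; apply; exact: ltW.
rewrite (_ : [set x | _] = (@Num.norm _ Rn) @^-1` [set y | y <= M])//.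
by apply: closed_comp; [move=> ? _; exact: norm_continuous|exact: closed_le].
Qed.

Lemma coord_norm_le v i : `|v ord0 i| <= `|v|.
Proof. by rewrite [leRHS]mx_normrE; apply/bigmax_geP; right; exists (ord0, i). Qed.

Lemma measurable_rV_box (B : 'I_N -> set (measurableTypeR R)) :
  (forall i, measurable (B i)) -> measurable [set v : Rn | forall i, B i (v ord0 i)].
Proof.
move=> mB; rewrite (_ : [set _ | _] = \bigcap_(i in [set: 'I_N])
    [set v : Rn | B i (v ord0 i)]); last first.
  by apply/seteqP; split => v /= h i; [move=> _; exact: h|exact: h].
apply: fin_bigcap_measurable => // i _; apply: borel_measurable.
by apply: sub_sigma_algebra; exists i, (B i).
Qed.

Lemma bounded_measure_lty Omega : measurable Omega -> bounded_set Omega ->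
  (leb Omega < +oo)%E.
Proof.
move=> mO /bounded_set_norm_le[M OM].
have mI (i : 'I_N) : measurable ([set` `[- M, M]] : set (measurableTypeR R)) by [].
apply: (@le_lt_trans _ _ (leb [set v : Rn | forall i, [set` `[- M, M]] (v ord0 i)])).
  apply: le_measure; rewrite ?inE//.
    exact: (measurable_rV_box (B := fun=> [set` `[- M, M]])).
  move=> v Ov i /=; rewrite in_itv/= -ler_norml.
  exact: le_trans (coord_norm_le v i) (OM v Ov).
rewrite (lebesgue_rV_prod (B := fun=> [set` `[- M, M]]))//.
have [r r0 ->] : exists2 r, 0 <= r & lebesgue_measure [set` `[- M, M]] = r%:E.
  rewrite lebesgue_measure_itv/= lte_fin; case: ifPn => [MM|_]; last by exists 0.
  by exists (M - - M) => //; rewrite subr_ge0 ltW.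
by rewrite prodEFin ltry.
Qed.

Section kernel.
Context V (hV : nonlocal_kernel V).

Lemma nonlocal_kernel_ge0 x y : 0 <= V x y. Proof. by case: hV. Qed.

Lemma nonlocal_kernelC x y : V x y = V y x. Proof. by case: hV. Qed.

Lemma nonlocal_kernel_measurable :
  measurable_fun [set: Rn * Rn] (fun p : Rn * Rn => V p.1 p.2).
Proof. by apply: continuous_kernel_measurable; case: hV. Qed.

Lemma measurable_nonlocal_kernel x : measurable_fun setT (V x).
Proof. exact: (measurableT_comp nonlocal_kernel_measurable (pair1_measurable x)). Qed.

Lemma integrable_nonlocal_kernel x : leb.-integrable setT (EFin \o V x).
Proof.
apply/integrableP; split; first exact/measurable_EFinP/measurable_nonlocal_kernel.
under eq_integral do rewrite /= ger0_norm ?nonlocal_kernel_ge0//.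
by case: hV => _ _ _ _ ->; rewrite ltry.
Qed.

Lemma nonlocal_kernel_mass x : \int[leb]_y V x y = 1.
Proof. by rewrite /Rintegral; case: hV => _ _ _ _ ->. Qed.

Lemma nonlocal_kernel_bounded Omega : bounded_set Omega ->
  exists2 C, 0 <= C & forall x y, Omega x -> Omega y -> V x y <= C.
Proof.
move=> /bounded_sub_compact[K cK OK]; case: hV => cV _ _ _ _.
have /compact_bounded : compact ((fun p : Rn * Rn => V p.1 p.2) @` (K `*` K)).
  apply: continuous_compact; last exact: compact_setX.
  exact: continuous_subspaceT.
move=> /bounded_set_norm_le[M KM]; exists (Num.max 0 M); first by rewrite le_max lexx.
move=> x y Ox Oy; rewrite le_max; apply/orP; right.
apply: le_trans (KM _ _); first exact: ler_norm.
by exists (x, y) => //; split; exact: OK.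
Qed.

(** Positivity on the diagonal is uniform over bounded sets, by compactness. *)
Lemma nonlocal_kernel_near_diag Omega : bounded_set Omega ->
  exists2 e, 0 < e & forall d, 0 < d <= e ->
    forall x y, Omega x -> ball x d y -> e <= V x y.
Proof.
move=> /bounded_sub_compact[K /compact_near_coveringP cK OK].
(* One number bounds both the radius and the values, so that the covering argument
   runs over a single small parameter. *)
pose P (e : R) x := forall y, ball x e y -> e <= V x y.
have : \forall e \near 0^'+, K `<=` P e.
  apply: cK => x0 Kx0.
  case: hV => cV _ /(_ x0) Vx0 _ _.
  have Vx20 : V x0 x0 / 2 < V x0 x0 by lra.
  have /nbhs_ballP[e /= e0 he] := cV (x0, x0) _ (lt_nbhsr Vx20).
  have Vx0' : 0 < V x0 x0 / 2 by rewrite divr_gt0.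
  near_simpl.
  exists (ball x0 (e / 2), [set d | 0 < d < Num.min (e / 2) (V x0 x0 / 2)]).
    split => /=; first by apply: nbhsx_ballx; rewrite divr_gt0.
    near=> d; apply/andP; split; first by near: d; exact: nbhs_right_gt.
    by near: d; apply: nbhs_right_lt; rewrite lt_min Vx0' divr_gt0.
  move=> [x d] [/= xe /andP[d0]]; rewrite lt_min => /andP[de dV] y xy.
  apply: ltW; apply: lt_trans dV _; apply: (he (x, y)); split => /=.
    by apply: le_ball xe; rewrite ler_pdivrMr//; lra.
  by apply: le_ball (ball_triangle xe xy); rewrite [leRHS]splitr lerD// ltW.
move=> near_K.
have [e [e0 eK]] : exists e, 0 < e /\ K `<=` P e.
  apply: (@filter_ex _ (0 : R)^'+); near=> e; split.
    by near: e; exact: nbhs_right_gt.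
  by near: e.
exists e => // d /andP[d0 de] x y Ox xy; apply: (eK _ (OK _ Ox)).
exact: le_ball de _ xy.
Unshelve. all: by end_near. Qed.

End kernel.
End lebesgue_rV_facts.

(** * A supersolution common to all partitions *)

Section barrier.
Context {R : realType} {N : nat}.
Local Notation Rn := 'rV[R]_N.
Local Notation leb := (@lebesgue_rV R N).
Local Notation integrableR f := (leb.-integrable setT (EFin \o f)).

(** A jump with rate [k] increases the coordinate [i0] by more than [e / 2] with
    total rate at least [kappa], a number that depends only on [e] and the dimension.
    The function [M - exp (lam * x i0)], cut to 0 outside [Omega], loses much under
    such a jump or under an exit from [Omega], and gains at most [exp (lam * x i0)]
    under any other jump. For [lam] large the losses prevail. *)
Lemma uniform_barrier (i0 : 'I_N) (Omega : set Rn) (e : R) :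
  bounded_set Omega -> measurable Omega -> 0 < e ->
  exists (h : Rn -> R) (c kappa M : R), [/\ 0 < c, 0 < kappa, measurable_fun setT h,
    forall x : Rn, 0 <= h x <= M & forall x, ~ Omega x -> h x = 0] /\
    forall (x : Rn) (k : Rn -> R), Omega x -> integrableR k -> (forall y, 0 <= k y) ->
      \int[leb]_y k y <= 2 -> (forall y, ball x e y -> e <= k y) ->
      kappa <= \int[leb]_y k y /\
      \int[leb]_y (k y * h y) + c <= (\int[leb]_y k y) * h x.
Proof.
move=> /bounded_set_norm_le[rho Orho] mO e0.
(* A lower bound for the mass of [k] on the cube [box] below. *)
pose kappa := e * (e / 2) ^+ N.
have kappa0 : 0 < kappa by rewrite mulr_gt0// exprn_gt0// divr_gt0.
(* This choice gives [3 <= kappa * expR (lam * (e / 2))]; the excess of 3 over the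
   total mass 2 is what remains in the final estimate. *)
pose lam := 6 / (kappa * e).
have lam0 : 0 < lam by rewrite divr_gt0// mulr_gt0.
pose M := expR (lam * (rho + e)).
pose s (x : Rn) := expR (lam * x ord0 i0).
pose h := patch (fun=> 0) Omega (fun x => M - s x).
have s0 x : 0 < s x by exact: expR_gt0.
have xrho x : Omega x -> - rho <= x ord0 i0 <= rho.
  by move=> Ox; rewrite -ler_norml (le_trans (coord_norm_le x i0))// Orho.
pose E := expR (lam * (e / 2)).
have E3 : 3 <= kappa * E.
  apply: (@le_trans _ _ (kappa * (1 + lam * (e / 2)))).
    rewrite /lam mulrDr mulr1.
    have -> : kappa * (6 / (kappa * e) * (e / 2)) = 3.
      by field; rewrite !gt_eqF.
    by rewrite lerDr ltW.
  by rewrite ler_pM2l// expR_ge1Dx.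
have sM x : Omega x -> s x * E <= M.
  move=> /xrho/andP[_ xr]; rewrite -expRD ler_expR -mulrDr ler_pM2l//.
  by rewrite lerD// ler_pdivrMr//; lra.
have E1 : 1 <= E by rewrite -expR0 ler_expR mulr_ge0 ?ltW// divr_gt0.
have hM x : 0 <= h x <= M.
  rewrite /h/patch; case: ifPn => [/set_mem Ox|_]; last first.
    by rewrite lexx expR_ge0.
  rewrite subr_ge0 lerBlDr lerDl (ltW (s0 x)) andbT.
  by rewrite (le_trans _ (sM x Ox))// ler_peMr// ltW.
have mcoord : measurable_fun setT (fun x : Rn => x ord0 i0).
  by apply: continuous_rV_measurable; exact: coord_continuous.
have ms : measurable_fun setT s.
  have := measurable_funM (@measurable_cst _ _ _ _ setT lam) mcoord.
  exact: measurableT_comp (@measurable_expR R).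
have mh : measurable_fun setT h.
  apply/(measurable_restrictT _ mO)/measurable_funTS.
  exact: measurable_funB (@measurable_cst _ _ _ _ setT M) ms.
exists h, (expR (- (lam * rho))), kappa, M; split; first split => //.
- exact: expR_gt0.
- by move=> x Ox; rewrite /h /patch memNset.
move=> x k Ox ik k0 k2 ke.
pose B i : set (measurableTypeR R) := [set` `]x ord0 i + e / 2, x ord0 i + e[].
pose box := [set y : Rn | forall i, B i (y ord0 i)].
have mbox : measurable box by apply: measurable_rV_box => i; exact: measurable_itv.
have box_vol : leb box = ((e / 2) ^+ N)%:E.
  rewrite lebesgue_rV_prod; last by move=> i; exact: measurable_itv.
  rewrite (eq_bigr (fun=> (e / 2)%:E)) => [|i _].
    by rewrite prodEFin prodr_const card_ord.
  rewrite lebesgue_measure_itv/= lte_fin ltrD2l ltr_pdivrMr// ltr_pMr// ltr1n.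
  by rewrite -EFinB; congr EFin; lra.
have box_ball y : box y -> ball x e y.
  move=> yB; split => // i j; rewrite ord1 /ball/=.
  have := yB j; rewrite /B/= in_itv/= => /andP[y1 y2].
  by rewrite ltr_norml; apply/andP; split; lra.
have i_box : integrableR (\1_box : Rn -> R).
  apply/integrableP; split; first exact/measurable_EFinP/measurable_indic.
  under eq_integral do rewrite /= ger0_norm//.
  by rewrite integral_indic// setIT [ltLHS]box_vol ltry.
have int_box : \int[leb]_y (\1_box y : R) = (e / 2) ^+ N.
  by rewrite /Rintegral integral_indic// setIT; exact: (congr1 fine box_vol).
have i_kbox : integrableR (fun y => \1_box y * k y).
  by apply: (@integrable_mul_bounded _ _ _ _ _ _ 1) => // y; rewrite indicE; case: (_ \in _); rewrite ?normr1 ?normr0.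
have kbox : kappa <= \int[leb]_y (\1_box y * k y).
  rewrite /kappa -int_box -RintegralZl//.
  apply: le_RintegralT => // [|y]; first exact: integrable_scale.
  rewrite indicE; case: (boolP (y \in box)) => [/set_mem yb|_].
    by rewrite mulr1 mul1r ke//; exact: box_ball.
  by rewrite mulr0 mul0r.
have kk : \int[leb]_y (\1_box y * k y) <= \int[leb]_y k y.
  apply: le_RintegralT => // y; rewrite indicE.
  by case: (_ \in _); rewrite ?mul1r ?mul0r.
split; first exact: le_trans kk.
have i_kh : integrableR (fun y => k y * h y).
  under [X in integrable _ _ X]eq_fun do rewrite /= [X in X%:E]mulrC.
  apply: (@integrable_mul_bounded _ _ _ _ _ _ M) => // y.
  by have /andP[h0 ?] := hM y; rewrite ger0_norm.
have hx : h x = M - s x by rewrite /h /patch mem_set.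
have key : \int[leb]_y (k y * h y + s x * E * (\1_box y * k y)) <=
    \int[leb]_y ((h x + s x) * k y).
  apply: le_RintegralT => [||y].
  - by apply: integrableRD => //; exact: integrable_scale.
  - exact: integrable_scale.
  have -> : k y * h y + s x * E * (\1_box y * k y) =
      (h y + s x * E * \1_box y) * k y by ring.
  rewrite hx subrK ler_wpM2r// indicE.
  case: (boolP (y \in box)) => [/set_mem/(_ i0)|_]; last first.
    by rewrite mulr0 addr0; have /andP[] := hM y.
  rewrite /B/= in_itv/= => /andP[xy _]; rewrite mulr1 /h/patch.
  case: ifPn => [_|_]; last by rewrite add0r sM.
  rewrite -addrA gerDl addrC subr_le0 /s -expRD ler_expR -mulrDr.
  by rewrite ler_pM2l// ltW.
have sxE : 3 * s x <= s x * E * \int[leb]_y (\1_box y * k y).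
  rewrite mulrC -mulrA ler_pM2l// (le_trans E3)// mulrC ler_pM2l//.
  exact: lt_le_trans E1.
have sx_ge : expR (- (lam * rho)) <= s x.
  by rewrite ler_expR -mulrN ler_pM2l//; have /andP[] := xrho x Ox.
have sk : s x * \int[leb]_y k y <= s x * 2 by rewrite ler_pM2l.
move: key; rewrite RintegralD//; last exact: integrable_scale.
rewrite !RintegralZl// mulrDl => key; rewrite [leRHS]mulrC.
have arith (I b k' s' c h' : R) : I + b <= h' * k' + s' * k' ->
  3 * s' <= b -> c <= s' -> s' * k' <= s' * 2 -> I + c <= h' * k'.
  by clear; lra.
exact: arith key sxE sx_ge sk.
Qed.

End barrier.

(** * The phase space *)

Section phase_space.
Context d (T : measurableType d) (R : realType) (mu : {measure set T -> \bar R})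
  (D : set T) (mD : measurable D).
Local Open Scope ereal_scope.

Definition phase_slice (s : bool) : {measure set (bool * T) -> \bar R}.
Proof.
refine (pushforward (mrestr mu mD) (pair s) : {measure set (bool * T) -> \bar R}).
exact: pair1_measurable.
Defined.

(** Two copies of [mu] restricted to [D], one for each phase. The finiteness of [mu D]
    is an argument so that the structure of finite measure can be inferred. *)
Definition phase_measure (_ : mu D < +oo) : set (bool * T) -> \bar R :=
  measure_add (phase_slice true) (phase_slice false).

HB.instance Definition _ (muD : mu D < +oo) := Measure.on (phase_measure muD).

Context (muD : mu D < +oo).

Let phase_measure_fin : fin_num_fun (phase_measure muD).
Proof.
suff slice_fin s A : measurable A -> phase_slice s A \is a fin_num.
  by move=> A mA; rewrite /phase_measure measure_addE fin_numD !slice_fin.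
move=> mA; rewrite ge0_fin_numE//; apply: le_lt_trans muD.
rewrite /= /pushforward /mrestr; apply: le_measure; rewrite ?inE//.
apply: measurableI => //; rewrite -[X in measurable X]setTI.
exact: pair1_measurable.
Qed.

HB.instance Definition _ := @Measure_isFinite.Build _ _ _ (phase_measure muD) phase_measure_fin.

Lemma ge0_integral_mrestr (f : T -> \bar R) : measurable_fun setT f ->
  (forall x, 0 <= f x) -> \int[mrestr mu mD]_x f x = \int[mu]_(x in D) f x.
Proof.
move=> mf f0; rewrite (@ge0_negligible_integral _ _ _ _ setT (~` D))//; first last.
- by rewrite /= /mrestr setICl measure0.
- exact: measurableC.
rewrite setTD setCK; apply: eq_measure_integral => A mA AD.
by rewrite /= /mrestr setIidl.
Qed.

Lemma ge0_integral_phase (f : bool * T -> \bar R) : measurable_fun setT f ->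
  (forall z, 0 <= f z) ->
  \int[phase_measure muD]_z f z =
  \int[mu]_(x in D) f (true, x) + \int[mu]_(x in D) f (false, x).
Proof.
move=> mf f0; rewrite /phase_measure ge0_integral_measure_add//.
suff slice_int s : \int[phase_slice s]_z f z = \int[mu]_(x in D) f (s, x).
  by rewrite !slice_int.
rewrite -(@ge0_integral_mrestr (fun x => f (s, x)))//.
  rewrite [LHS]ge0_integral_pushforward//.
exact: measurableT_comp mf (pair1_measurable _).
Qed.

Lemma measurable_phaseP d' (U : measurableType d') (f : bool * T -> U) :
  (forall s, measurable_fun setT (fun x => f (s, x))) <-> measurable_fun setT f.
Proof.
split=> [mf|mf s]; last exact: measurableT_comp mf (pair1_measurable s).
rewrite (_ : f = fun z => if z.1 then f (true, z.2) else f (false, z.2)).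
  apply: measurable_fun_ifT => //; exact: measurableT_comp (mf _) measurable_snd.
by apply/funext => -[[] x].
Qed.

Lemma integrable_phaseP (f : bool * T -> R) : measurable_fun setT f ->
  (forall s, mu.-integrable D (fun x => (f (s, x))%:E)) <->
  (phase_measure muD).-integrable setT (EFin \o f).
Proof.
move=> mf; have mf_s s : measurable_fun D (fun x => (f (s, x))%:E).
  by apply/measurable_EFinP/measurable_funTS; exact: ((measurable_phaseP f).2 mf).
have mfE : measurable_fun setT (EFin \o f) by exact/measurable_EFinP.
have nE : \int[phase_measure muD]_z `|(f z)%:E| = \int[mu]_(x in D) `|(f (true, x))%:E| +
    \int[mu]_(x in D) `|(f (false, x))%:E|.
  by rewrite ge0_integral_phase//; exact: measurableT_comp.
have i0 s : 0 <= \int[mu]_(x in D) `|(f (s, x))%:E| by exact: integral_ge0.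
split=> [i_f|/integrableP[_]].
  apply/integrableP; split => //; rewrite nE lte_add_pinfty//.
    by have /integrableP[] := i_f true.
  by have /integrableP[] := i_f false.
rewrite nE => flty s; apply/integrableP; split => //.
by apply: le_lt_trans flty; case: s; [exact: leeDl|exact: leeDr].
Qed.

Lemma Rintegral_phase (f : bool * T -> R) :
  (phase_measure muD).-integrable setT (EFin \o f) ->
  (\int[phase_measure muD]_z f z =
   \int[mu]_(x in D) f (true, x) + \int[mu]_(x in D) f (false, x))%R.
Proof.
move=> i_f; have mf := integrable_measurable i_f.
have i_s s : mu.-integrable D (fun x => (f (s, x))%:E).
  exact: ((integrable_phaseP mf).2 i_f).
rewrite /Rintegral -fineD; [|exact: integrable_fin_num..].
congr fine; rewrite integralE !ge0_integral_phase//; first last.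
- exact/measurable_funepos/measurable_EFinP.
- exact/measurable_funeneg/measurable_EFinP.
have pE s : \int[mu]_(x in D) (EFin \o f)^\+ (s, x) =
    \int[mu]_(x in D) (fun x => (f (s, x))%:E)^\+ x.
  by apply: eq_integral => x _; rewrite !funeposE.
have nE s : \int[mu]_(x in D) (EFin \o f)^\- (s, x) =
    \int[mu]_(x in D) (fun x => (f (s, x))%:E)^\- x.
  by apply: eq_integral => x _; rewrite !funenegE.
have n_fin s : \int[mu]_(x in D) (fun x => (f (s, x))%:E)^\- x \is a fin_num.
  exact: (integrable_fin_num mD (integrable_funeneg mD (i_s s))).
rewrite !pE !nE fin_num_oppeD// addeACA.
by congr (_ + _); rewrite [RHS]integralE.
Qed.

End phase_space.

(** * Essentially bounded coefficients and weak convergence *)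

Section essentially_bounded.
Context d (T : measurableType d) (R : realType) (mu : {measure set T -> \bar R}).
Implicit Types f g w : T -> R.
Local Notation integrableR f := (mu.-integrable [set: T] (EFin \o f)).

Definition essentially_bounded g :=
  measurable_fun setT g /\ exists M, {ae mu, forall x, `|g x| <= M}.

Lemma Lfun_oo_essentially_bounded g : g \in Lfun mu +oo%E -> essentially_bounded g.
Proof.
rewrite inE => /andP[/[!inE]/= mg]; rewrite /finite_norm unlock => gfin; split => //.
move: gfin; case: ifPn => [_ gfin|].
  have /ess_supr_bounded[M gM] : (ess_sup mu (EFin \o (fun x => `|g x|)%R) < +oo)%E by [].
  by exists M; apply: filterS gM.
rewrite -leNgt => mu0 _; exists 0; exists setT; split => //.
by apply/eqP; rewrite eq_le mu0 measure_ge0.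
Qed.

Lemma ae_eq_Rintegral f g : measurable_fun setT f -> measurable_fun setT g ->
  {ae mu, forall x, f x = g x} -> \int[mu]_x f x = \int[mu]_x g x.
Proof.
move=> mf mg fg; congr fine; apply: ae_eq_integral => //; try exact/measurable_EFinP.
by apply: filterS fg => x /= -> _.
Qed.

Lemma integrable_mul_essentially_bounded g w :
  essentially_bounded g -> integrableR w -> integrableR (fun x => g x * w x).
Proof.
move=> [mg [M gM]] iw; have mw := integrable_measurable iw.
have iMw := integrable_scale `|M| (integrable_norm_fun iw).
have mgw : measurable_fun setT (fun x => (g x * w x)%:E).
  exact/measurable_EFinP/measurable_funM.
apply/integrableP; split => //.
have /integrableP[mMw] := iMw; apply: le_lt_trans.
apply: ae_ge0_le_integral => //; try exact: measurableT_comp.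
apply: filterS gM => x gxM _ /=; rewrite lee_fin !normrM !normr_id ler_wpM2r//.
exact: le_trans gxM (ler_norm M).
Qed.

Lemma sqr_integrable_Lfun2 f : measurable_fun setT f ->
  integrableR (fun x => f x ^+ 2) -> f \in Lfun mu 2%:E.
Proof.
move=> mf /integrableP[_ if2]; apply/andP; split; rewrite inE//=.
rewrite /finite_norm unlock poweR_lty//; apply: le_lt_trans if2.
rewrite le_eqVlt; apply/orP; left; apply/eqP; apply: eq_integral => x _ /=.
by rewrite powR_mulrn// normrX.
Qed.

Lemma Lfun2_mul_integrable f g : f \in Lfun mu 2%:E -> g \in Lfun mu 2%:E ->
  integrableR (fun x => f x * g x).
Proof. by move=> f2 g2; exact: (Lfun1_integrable _ _).1 (Lfun2_mul_Lfun1 f2 g2). Qed.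

(** Weak times strong: by dominated convergence the integrands converge in L1, and
    the coefficients are bounded. *)
Lemma weak_star_mul_dominated_cvg (theta w_ : (T -> R)^nat) (X w G : T -> R) :
  (forall n, measurable_fun setT (theta n)) -> (forall n x, `|theta n x| <= 1) ->
  (forall v, integrableR v ->
    \int[mu]_x (theta n x * v x) @[n --> \oo] --> \int[mu]_x (X x * v x)) ->
  (forall n, measurable_fun setT (w_ n)) ->
  (forall x, w_ n x @[n --> \oo] --> w x) ->
  integrableR G -> (forall n x, `|w_ n x| <= G x) ->
  \int[mu]_x (theta n x * w_ n x) @[n --> \oo] --> \int[mu]_x (X x * w x).
Proof.
move=> mtheta theta1 theta_cvg mw_ w_w iG w_G.
have mw : measurable_fun setT w by exact: measurable_fun_cvg mw_ (fun x _ => w_w x).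
have iw_ n : integrableR (w_ n) by exact: integrable_dominated iG _.
have wG x : `|w x| <= G x.
  have cnw : `|w_ n x| @[n --> \oo] --> `|w x| by exact: cvg_norm.
  rewrite -(cvg_lim (@Rhausdorff R) cnw); apply: limr_le.
    by apply/cvg_ex; exists `|w x|.
  exact: nearW.
have iw : integrableR w by exact: integrable_dominated iG _.
have err0 : \int[mu]_x (theta n x * (w_ n x - w x)) @[n --> \oo] --> 0.
  rewrite -[X in _ --> X](_ : \int[mu]_x (cst 0 x : R) = 0); last first.
    by rewrite Rintegral_cst// mul0r.
  apply: (@dominated_cvg_Rintegral _ _ _ _ _ _ (fun x => 2 * G x)).
  - by move=> n; apply: measurable_funM => //; exact: measurable_funB.
  - move=> x; apply: (@cvg0_le R _ (fun n => `|w_ n x - w x|)) => [n|].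
      by rewrite normrM -[leRHS]mul1r ler_pM.
    apply/norm_cvg0P; rewrite -(subrr (w x)); apply: cvgB; first exact: w_w.
    exact: cvg_cst.
  - exact: integrable_scale.
  - move=> n x; rewrite normrM -[leRHS]mul1r ler_pM//.
    by rewrite (le_trans (ler_normB _ _))// mulr_natl mulr2n lerD.
rewrite -[X in _ --> X]add0r.
have -> : (fun n => \int[mu]_x (theta n x * w_ n x)) =
    (fun n => \int[mu]_x (theta n x * (w_ n x - w x)) + \int[mu]_x (theta n x * w x)).
  apply/funext => n; rewrite -RintegralD//.
  - by apply: eq_Rintegral => x _; ring.
  - by apply: integrable_mul_bounded => //; exact: integrableRB.
  - exact: integrable_mul_bounded.
by apply: cvgD err0 _; exact: theta_cvg.
Qed.

End essentially_bounded.

(** * The Dirichlet problem in terms of phases *)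

Section dirichlet_phases.
Context {R : realType} {N : nat}.
Local Notation Rn := 'rV[R]_N.
Local Notation leb := (@lebesgue_rV R N).
Local Notation integrableR f := (leb.-integrable [set: Rn] (EFin \o f)).

(** Phase [true] belongs to the sets called [A] and phase [false] to those called [B]. *)
Definition phase_kernel (J G K : Rn -> Rn -> R) (s t : bool) : Rn -> Rn -> R :=
  if s then if t then J else K else if t then K else G.

Definition phase_indic (A B : set Rn) (s : bool) : Rn -> R := \1_(if s then A else B).

Context (J G K : Rn -> Rn -> R)
  (hJ : nonlocal_kernel J) (hG : nonlocal_kernel G) (hK : nonlocal_kernel K).
Local Notation V := (phase_kernel J G K).

Lemma phase_kernelP s t : nonlocal_kernel (V s t).
Proof. by case: s; case: t. Qed.

Lemma phase_kernelC s t x y : V s t x y = V t s y x.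
Proof. by case: s; case: t; apply: nonlocal_kernelC. Qed.

Context (Omega : set Rn) (mO : measurable Omega) (bO : bounded_set Omega).

Let leb_Omega : (leb Omega < +oo)%E. Proof. exact: bounded_measure_lty. Qed.

Lemma integrable_indic_Omega : integrableR (\1_Omega : Rn -> R).
Proof.
apply/integrableP; split; first exact/measurable_EFinP/measurable_indic.
under eq_integral do rewrite /= ger0_norm//.
by rewrite integral_indic// setIT.
Qed.

Lemma phase_kernel_bounded : exists2 C, 0 <= C &
  forall s t x y, Omega x -> Omega y -> V s t x y <= C.
Proof.
have [C C0 hC] := nonlocal_kernel_bounded hJ bO.
have [C' C'0 hC'] := nonlocal_kernel_bounded hG bO.
have [C'' C''0 hC''] := nonlocal_kernel_bounded hK bO.
exists (C + C' + C''); first by rewrite !addr_ge0.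
move=> s t x y Ox Oy.
have := hC x y Ox Oy; have := hC' x y Ox Oy; have := hC'' x y Ox Oy.
by case: s; case: t; rewrite /phase_kernel; lra.
Qed.

Lemma integrable_phase_kernel_mul s t x w : Omega x -> integrableR w ->
  (forall y, ~ Omega y -> w y = 0) -> integrableR (fun y => V s t x y * w y).
Proof.
move=> Ox iw wO; have [C C0 hC] := phase_kernel_bounded.
have hV := phase_kernelP s t.
apply: (@integrable_dominated _ _ _ _ _ (fun y => C * `|w y|)).
- apply: measurable_funM; last exact: integrable_measurable iw.
  exact: (measurable_nonlocal_kernel hV).
- exact/integrable_scale/integrable_norm_fun.
- move=> y; have [Oy|/wO ->] := pselect (Omega y); last by rewrite normr0 !mulr0 normr0.
  by rewrite normrM ler_wpM2r// ger0_norm ?nonlocal_kernel_ge0// hC.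
Qed.

Section one_partition.
Context (A B : set Rn) (mA : measurable A) (mB : measurable B)
  (AUB : A `|` B = setT) (AIB : A `&` B = set0).
Local Notation chi := (phase_indic A B).

(** The phase [s] is given to [x] whichever of [A] and [B] contains [x], while [y] has
    the phase of the set that contains it. The equation of each phase can then be
    written at every point, and its coefficients depend on the partition only through
    integrals. *)
Definition jump_rate s x y := V s true x y * chi true y + V s false x y * chi false y.

Definition total_rate s x := \int[leb]_y jump_rate s x y.

Definition jump_potential (w : Rn -> R) s x := \int[leb]_y (jump_rate s x y * w y).

Lemma measurable_phase_indic s : measurable_fun setT (chi s).
Proof. by apply: measurable_indic; case: s. Qed.

Lemma phase_indic01 s x : 0 <= chi s x <= 1.
Proof. by rewrite /phase_indic indicE; case: (_ \in _); rewrite lexx ler01. Qed.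

Lemma phase_indic_norm s x : `|chi s x| <= 1.
Proof. by have /andP[c0 c1] := phase_indic01 s x; rewrite ger0_norm. Qed.

Lemma phase_indic_false x : chi false x = 1 - chi true x.
Proof.
rewrite /phase_indic !indicE /=; have [Ax|nAx] := pselect (A x).
  have nBx : ~ B x by move=> Bx; have : (A `&` B) x by []; rewrite AIB.
  by rewrite (mem_set Ax) (memNset nBx) subrr.
have Bx : B x.
  have : (A `|` B) x by rewrite AUB.
  by case.
by rewrite (memNset nAx) (mem_set Bx) subr0.
Qed.

Lemma integrable_kernel_indic s t x : integrableR (fun y => V s t x y * chi t y).
Proof.
under [X in integrable _ _ X]eq_fun do rewrite /= [X in X%:E]mulrC.
apply: (@integrable_mul_bounded _ _ _ _ _ _ 1).
- exact: measurable_phase_indic.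
- exact: phase_indic_norm.
- exact/integrable_nonlocal_kernel/phase_kernelP.
Qed.

Lemma integrable_jump_rate s x : integrableR (jump_rate s x).
Proof. by apply: integrableRD; exact: integrable_kernel_indic. Qed.

Lemma jump_rate_ge0 s x y : 0 <= jump_rate s x y.
Proof.
have chi0 t : 0 <= chi t y by have /andP[] := phase_indic01 t y.
have V0 t := nonlocal_kernel_ge0 (phase_kernelP s t) x y.
by rewrite /jump_rate addr_ge0// mulr_ge0.
Qed.

Lemma total_rate_le2 s x : total_rate s x <= 2.
Proof.
rewrite /total_rate /jump_rate RintegralD//; [|exact: integrable_kernel_indic..].
have le1 t : \int[leb]_y (V s t x y * chi t y) <= 1.
  rewrite -(nonlocal_kernel_mass (phase_kernelP s t) x).
  apply: le_RintegralT => [||y].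
  - exact: integrable_kernel_indic.
  - exact/integrable_nonlocal_kernel/phase_kernelP.
  - have V0 := nonlocal_kernel_ge0 (phase_kernelP s t) x y.
    by rewrite ler_piMr//; have /andP[] := phase_indic01 t y.
by rewrite -[leRHS]/(1 + 1) lerD.
Qed.

Lemma jump_rate_lower s x y e : (forall t, e <= V s t x y) -> e <= jump_rate s x y.
Proof.
move=> eV; rewrite /jump_rate phase_indic_false.
have /andP[c0 c1] := phase_indic01 true y.
have := ler_wpM2r c0 (eV true).
have c0' : 0 <= 1 - chi true y by rewrite subr_ge0.
have := ler_wpM2r c0' (eV false); lra.
Qed.

Context (f u : Rn -> R) (hu : dirichlet_solution J G K Omega A B f u).

Definition cut_off (w : Rn -> R) x := \1_Omega x * w x.

Lemma cut_off_out w x : ~ Omega x -> cut_off w x = 0.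
Proof. by move=> Ox; rewrite /cut_off indicE memNset// mul0r. Qed.

Lemma integrable_solution : integrableR (cut_off u).
Proof.
have [[uL2 _] _] := hu.
have := Lfun2_mul_integrable uL2 uL2 => iu2.
have mu : measurable_fun setT u by move: uL2; rewrite inE => /andP[/[!inE]].
apply: (@integrable_dominated _ _ _ _ _ (fun x => \1_Omega x + u x * u x)).
- by apply: measurable_funM => //; exact: measurable_indic.
- exact: integrableRD integrable_indic_Omega iu2.
- move=> x; rewrite /cut_off indicE; case: (_ \in _) => /=; last first.
    by rewrite !mul0r normr0 add0r -expr2 sqr_ge0.
  by rewrite !mul1r -expr2 ler_norm_1Dsqr.
Qed.

Lemma solution_ae_cut_off : {ae leb, forall x, u x = cut_off u x}.
Proof.
have [[_ uO] _] := hu; apply: filterS uO => x /= uO.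
have [Ox|Ox] := pselect (Omega x); first by rewrite /cut_off indicE mem_set// mul1r.
by rewrite cut_off_out// uO.
Qed.

(** The factor [chi s x] keeps two of the four terms of the operator, those of phase
    [s]; the integrals over [A] and [B] then add up to
    [jump_potential s x - total_rate s x * u x]. *)
Lemma dirichlet_phase_equation : {ae leb, forall x, Omega x -> forall s,
  chi s x * (total_rate s x * u x) = chi s x * (jump_potential (cut_off u) s x - f x)}.
Proof.
have [[uL2 _] ueq] := hu.
have mu : measurable_fun setT u by move: uL2; rewrite inE => /andP[/[!inE]].
apply: filterS ueq => x fx Ox s; rewrite fx//.
pose P s t := \int[leb]_y (V s t x y * chi t y * cut_off u y).
pose Q s t := \int[leb]_y (V s t x y * chi t y).
have i_P s' t : integrableR (fun y => V s' t x y * chi t y * cut_off u y).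
  have iV := integrable_phase_kernel_mul s' t Ox integrable_solution (@cut_off_out u).
  have := integrable_mul_bounded (measurable_phase_indic t) (phase_indic_norm t) iV.
  by apply: eq_integrable => // y _ /=; congr EFin; ring.
have part s' t : \int[leb]_(y in if t then A else B) (V s' t x y * (u y - u x)) =
    P s' t - u x * Q s' t.
  have mD : measurable (if t then A else B) by case: t.
  have iV := integrable_kernel_indic s' t x.
  have iuV := integrable_scale (u x) iV.
  rewrite Rintegral_mkcond /P /Q -RintegralZl// -RintegralB//.
  apply: ae_eq_Rintegral.
  - apply/(measurable_restrictT _ mD)/measurable_funTS.
    apply: measurable_funM; last exact: measurable_funB.
    exact: (measurable_nonlocal_kernel (phase_kernelP s' t)).
  - exact: (integrable_measurable (integrableRB (i_P s' t) iuV)).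
  - apply: filterS solution_ae_cut_off => y /= <-.
    rewrite /patch /phase_indic indicE; case: (_ \in _) => /=; first by ring.
    by rewrite mulr0 mul0r mulr0 subr0.
have op : nonlocal_op J G K A B u x =
    chi true x * (P true true - u x * Q true true) +
    chi true x * (P true false - u x * Q true false) +
    chi false x * (P false true - u x * Q false true) +
    chi false x * (P false false - u x * Q false false).
  by rewrite -!part.
have rateE : total_rate s x = Q s true + Q s false.
  by rewrite /total_rate RintegralD//; exact: integrable_kernel_indic.
have potE : jump_potential (cut_off u) s x = P s true + P s false.
  rewrite /jump_potential /P -RintegralD//.
  by apply: eq_Rintegral => y _; rewrite /jump_rate; ring.
rewrite op rateE potE.
have [e|e] : chi true x = 0 \/ chi true x = 1.
- by rewrite /phase_indic indicE; case: (_ \in _); [right|left].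
- by clear rateE potE; case: s; rewrite !phase_indic_false !e; ring.
- by clear rateE potE; case: s; rewrite !phase_indic_false !e; ring.
Qed.

End one_partition.
End dirichlet_phases.

Section lifted_kernel.
Context {R : realType} {N : nat}.
Local Notation Rn := 'rV[R]_N.
Local Notation leb := (@lebesgue_rV R N).
Local Notation integrableR f := (leb.-integrable [set: Rn] (EFin \o f)).

Context (J G K : Rn -> Rn -> R)
  (hJ : nonlocal_kernel J) (hG : nonlocal_kernel G) (hK : nonlocal_kernel K).
Local Notation V := (phase_kernel J G K).
Context (Omega : set Rn) (mO : measurable Omega) (bO : bounded_set Omega).
Let muO : (leb Omega < +oo)%E := bounded_measure_lty mO bO.

(** The kernel of the system as a scalar kernel on the phase space. The cut-off to
    [Omega] makes it bounded. *)
Definition lifted_kernel (z z' : bool * Rn) : R :=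
  \1_Omega z.2 * \1_Omega z'.2 * V z.1 z'.1 z.2 z'.2.

Let Z : measurableType _ := (bool * Rn)%type.

Lemma measurable_lifted_kernel :
  measurable_fun setT (fun p : Z * Z => lifted_kernel p.1 p.2).
Proof.
have mx : measurable_fun setT (fun p : Z * Z => p.1.2).
  exact: measurableT_comp measurable_snd measurable_fst.
have my : measurable_fun setT (fun p : Z * Z => p.2.2).
  exact: measurableT_comp measurable_snd measurable_snd.
have ms : measurable_fun setT (fun p : Z * Z => p.1.1).
  exact: measurableT_comp measurable_fst measurable_fst.
have mt : measurable_fun setT (fun p : Z * Z => p.2.1).
  exact: measurableT_comp measurable_fst measurable_snd.
have mI : measurable_fun setT (\1_Omega : Rn -> R) by exact: measurable_indic.
have mV s t : measurable_fun setT (fun p : Z * Z => V s t p.1.2 p.2.2).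
  have h := nonlocal_kernel_measurable (phase_kernelP hJ hG hK s t).
  exact: (measurableT_comp h (measurable_fun_pair mx my)).
apply: measurable_funM.
  apply: measurable_funM; first exact: measurableT_comp mI mx.
  exact: measurableT_comp mI my.
rewrite (_ : (fun p : Z * Z => V p.1.1 p.2.1 p.1.2 p.2.2) = fun p : Z * Z =>
    if p.1.1 then if p.2.1 then V true true p.1.2 p.2.2 else V true false p.1.2 p.2.2
    else if p.2.1 then V false true p.1.2 p.2.2 else V false false p.1.2 p.2.2).
  by apply: measurable_fun_ifT => //; apply: measurable_fun_ifT => //; exact: mV.
by apply/funext => -[[[] x] [[] y]].
Qed.

Lemma lifted_kernelP : exists C, sym_bounded_kernel lifted_kernel C.
Proof.
have [C C0 hC] := phase_kernel_bounded hJ hG hK bO.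
exists C; split; first exact: measurable_lifted_kernel.
  move=> [s x] [t y]; rewrite /lifted_kernel/=.
  have V0 := nonlocal_kernel_ge0 (phase_kernelP hJ hG hK s t) x y.
  rewrite !indicE; case: (boolP (x \in Omega)) => [/set_mem Ox|_] /=; last first.
    by rewrite !mul0r lexx.
  case: (boolP (y \in Omega)) => [/set_mem Oy|_] /=; last by rewrite mulr0 mul0r lexx.
  by rewrite !mul1r V0 hC.
move=> [s x] [t y]; rewrite /lifted_kernel/= (phase_kernelC hJ hG hK).
by rewrite [X in X * _]mulrC.
Qed.

Context (A B : set Rn) (mA : measurable A) (mB : measurable B).

Lemma kernel_op_lifted w (W : Rn -> R) s x :
  Omega x -> integrableR W -> (forall y, ~ Omega y -> W y = 0) ->
  (phase_measure mO muO).-integrable setT (EFin \o w) ->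
  (forall t, {ae leb, forall y, Omega y -> w (t, y) = phase_indic A B t y * W y}) ->
  kernel_op (phase_measure mO muO) lifted_kernel w (s, x) =
  jump_potential J G K A B W s x.
Proof.
move=> Ox iW WO iw wE; have [C hC] := lifted_kernelP.
have mW := integrable_measurable iW.
have mw t : measurable_fun setT (fun y => w (t, y)).
  by apply: (measurable_phaseP w).2; exact: integrable_measurable iw.
have i_t t : integrableR (fun y => V s t x y * phase_indic A B t y * W y).
  have iV := integrable_phase_kernel_mul hJ hG hK bO s t Ox iW WO.
  have := integrable_mul_bounded (measurable_phase_indic mA mB t)
    (phase_indic_norm A B t) iV.
  by apply: eq_integrable => // y _ /=; congr EFin; ring.
have part t : \int[leb]_(y in Omega) (lifted_kernel (s, x) (t, y) * w (t, y)) =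
    \int[leb]_y (V s t x y * phase_indic A B t y * W y).
  rewrite Rintegral_mkcond; apply: ae_eq_Rintegral.
  - apply/(measurable_restrictT _ mO)/measurable_funTS.
    have mk := measurable_kernel_section hC (s, x).
    exact: (measurable_funM ((measurable_phaseP (lifted_kernel (s, x))).2 mk t) (mw t)).
  - exact: integrable_measurable (i_t t).
  - apply: filterS (wE t) => y /= wy; rewrite /patch /lifted_kernel/= !indicE.
    case: (boolP (y \in Omega)) => [/set_mem Oy|Oy].
      by rewrite wy// (mem_set Ox) !mul1r mulrA.
    by rewrite WO ?mulr0// => /mem_set; exact/negP.
rewrite /kernel_op Rintegral_phase//; last exact: (integrable_kernel hC (s, x) iw).
rewrite !part /jump_potential -RintegralD//.
by apply: eq_Rintegral => y _; rewrite /jump_rate; ring.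
Qed.

End lifted_kernel.

(** * The limit system *)

Section limit.
Context {R : realType} {N : nat}.
Local Notation Rn := 'rV[R]_N.
Local Notation leb := (@lebesgue_rV R N).
Local Notation integrableR f := (leb.-integrable [set: Rn] (EFin \o f)).

Context (i0 : 'I_N) (Omega : set Rn) (mO : measurable Omega) (bO : bounded_set Omega).
Context (J G K : Rn -> Rn -> R)
  (hJ : nonlocal_kernel J) (hG : nonlocal_kernel G) (hK : nonlocal_kernel K).
Context (A B : nat -> set Rn)
  (mA : forall n, measurable (A n)) (mB : forall n, measurable (B n))
  (AUB : forall n, A n `|` B n = setT) (AIB : forall n, A n `&` B n = set0).
Context (X f : Rn -> R) (hX : X \in Lfun leb +oo%E) (hf : L2 Omega f).
Context (u : nat -> Rn -> R)
  (hu : forall n, dirichlet_solution J G K Omega (A n) (B n) f (u n))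
  (hAX : weak_star_cvg (fun n => \1_(A n)) X).

Local Notation V := (phase_kernel J G K).
Local Notation chi n := (phase_indic (A n) (B n)).
Let hV s t : nonlocal_kernel (V s t) := phase_kernelP hJ hG hK s t.
Let muO : (leb Omega < +oo)%E := bounded_measure_lty mO bO.
Let muZ := phase_measure mO muO.

(** The weak-* limits of the two indicators. *)
Definition limit_density (X' : Rn -> R) (s : bool) x := if s then X' x else 1 - X' x.
Local Notation xi := (limit_density X).

Let X_bounded : essentially_bounded leb X.
Proof. exact: Lfun_oo_essentially_bounded. Qed.

Let xi_bounded s : essentially_bounded leb (xi s).
Proof.
have [mX [M XM]] := X_bounded; case: s; first exact: X_bounded.
split.
  rewrite /limit_density /=.
  by apply: measurable_funB => //; exact: mX.
exists (1 + M); apply: filterS XM => x XM.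
by rewrite (le_trans (ler_normB _ _))// normr1 lerD2l.
Qed.

Let m_chi n s : measurable_fun setT (chi n s).
Proof. exact: measurable_phase_indic. Qed.

Let i_chi n s w : integrableR w -> integrableR (fun x => chi n s x * w x).
Proof.
by move=> iw; apply: integrable_mul_bounded iw => //; exact: phase_indic_norm.
Qed.

Let chi_cvg s w : integrableR w ->
  \int[leb]_x (chi n s x * w x) @[n --> \oo] --> \int[leb]_x (xi s x * w x).
Proof.
move=> iw; have := hAX ((Lfun1_integrable _ _).2 iw); case: s => // cA.
have iXw : integrableR (fun x => X x * w x).
  exact: integrable_mul_essentially_bounded X_bounded iw.
have -> : \int[leb]_x (xi false x * w x) = \int[leb]_x w x - \int[leb]_x (X x * w x).
  by rewrite -RintegralB//; apply: eq_Rintegral => x _; rewrite /xi; ring.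
have -> : (fun n => \int[leb]_x (chi n false x * w x)) =
    (fun n => \int[leb]_x w x - \int[leb]_x (\1_(A n) x * w x)).
  apply/funext => n; rewrite -RintegralB//; last exact: (i_chi n true).
  apply: eq_Rintegral => x _; rewrite (phase_indic_false (AUB n) (AIB n)).
  by rewrite /phase_indic; ring.
by apply: cvgB; first exact: cvg_cst.
Qed.

Let f0 := patch (fun=> 0) Omega f.

Let f0_out x : ~ Omega x -> f0 x = 0.
Proof. by move=> Ox; rewrite /f0 /patch memNset. Qed.

Let f0E x : Omega x -> f0 x = f x.
Proof. by move=> Ox; rewrite /f0 /patch mem_set. Qed.

Let L2_integrable w : w \in Lfun leb 2%:E -> (forall x, ~ Omega x -> w x = 0) ->
  integrableR w.
Proof.
move=> w2 wO; have iw2 := Lfun2_integrable_sqr w2.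
apply: (@integrable_dominated _ _ _ _ _ (fun x => \1_Omega x + w x ^+ 2)).
- by move: w2; rewrite inE => /andP[/[!inE]].
- by apply: integrableRD => //; exact: integrable_indic_Omega.
- move=> x; rewrite indicE; case: (boolP (x \in Omega)) => [_|/negP Ox] /=; last first.
    by rewrite wO ?normr0 ?addr_ge0 ?sqr_ge0// => /mem_set.
  exact: ler_norm_1Dsqr.
Qed.

Let i_f0 : integrableR f0. Proof. exact: L2_integrable. Qed.

Let m_f0 : measurable_fun setT f0. Proof. exact: integrable_measurable i_f0. Qed.

Let U n := cut_off Omega (u n).

Let i_U n : integrableR (U n).
Proof. exact: (integrable_solution mO bO (hu n)). Qed.

Let U_out n x : ~ Omega x -> U n x = 0. Proof. exact: cut_off_out. Qed.

Let dR n s x := total_rate J G K (A n) (B n) s x.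
Let gR n s x := jump_potential J G K (A n) (B n) (U n) s x.

(** The Dirichlet equation solved for the solution as if all of [Omega] were in phase
    [s]. Contrary to [u n], these functions converge pointwise. *)
Let phi n s x := \1_Omega x * ((gR n s x - f0 x) / dR n s x).

Let phi_out n s x : ~ Omega x -> phi n s x = 0.
Proof. by move=> Ox; rewrite /phi indicE memNset// mul0r. Qed.

Let near_diag : exists2 e, 0 < e &
  forall s t x y, Omega x -> ball x e y -> e <= V s t x y.
Proof.
have [e1 e10 h1] := nonlocal_kernel_near_diag hJ bO.
have [e2 e20 h2] := nonlocal_kernel_near_diag hG bO.
have [e3 e30 h3] := nonlocal_kernel_near_diag hK bO.
pose e := Num.min e1 (Num.min e2 e3).
have e0 : 0 < e by rewrite !lt_min e10 e20.
have [l1 l2 l3] : [/\ e <= e1, e <= e2 & e <= e3].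
  by rewrite !ge_min !lexx !orbT.
exists e => // s t x y Ox exy.
have := h1 e _ x y Ox exy; have := h2 e _ x y Ox exy; have := h3 e _ x y Ox exy.
rewrite e0 l1 l2 l3 => /(_ isT)/(le_trans l3) K1 /(_ isT)/(le_trans l2) K2.
by move=> /(_ isT)/(le_trans l1) K3; case: s; case: t.
Qed.

Let rate_limit s x := \int[leb]_y (V s true x y * xi true y) +
  \int[leb]_y (V s false x y * xi false y).

Let dR_cvg s x : dR n s x @[n --> \oo] --> rate_limit s x.
Proof.
have part t : \int[leb]_y (V s t x y * chi n t y) @[n --> \oo] -->
    \int[leb]_y (V s t x y * xi t y).
  have := @chi_cvg t (V s t x) (integrable_nonlocal_kernel (hV s t) x).
  under eq_fun do under eq_Rintegral do rewrite mulrC.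
  by under [X in _ --> X -> _]eq_Rintegral do rewrite mulrC.
have -> : (fun n => dR n s x) = (fun n => \int[leb]_y (V s true x y * chi n true y) +
    \int[leb]_y (V s false x y * chi n false y)).
  apply/funext => n; rewrite /dR /total_rate RintegralD//;
    exact: integrable_kernel_indic.
exact: cvgD.
Qed.

Let Phi n (z : bool * Rn) := phi n z.1 z.2.
Let Theta n (z : bool * Rn) := chi n z.1 z.2.
(** Outside [Omega] the lifted kernel and the solutions vanish; the rate 1 makes the
    lifted equation hold there too. *)
Let Dn n (z : bool * Rn) := if z.2 \in Omega then dR n z.1 z.2 else 1.
Let F0 (z : bool * Rn) := f0 z.2.

(** The constants of [uniform_barrier] depend only on a lower bound of the kernels near
    the diagonal, hence not on the partition. *)
Let rate_barrier : exists (h : Rn -> R) (c kappa M : R),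
  [/\ 0 < c, 0 < kappa, measurable_fun setT h, forall x, 0 <= h x <= M &
      forall x, ~ Omega x -> h x = 0] /\
  forall n s x, Omega x -> kappa <= dR n s x /\
    jump_potential J G K (A n) (B n) h s x + c <= dR n s x * h x.
Proof.
have [e e0 near] := near_diag.
have [h [c [kappa [M [hprop bar]]]]] := uniform_barrier i0 bO mO e0.
exists h, c, kappa, M; split=> // n s x Ox; apply: bar => //.
- exact: integrable_jump_rate.
- exact: jump_rate_ge0.
- exact: (total_rate_le2 hJ hG hK (mA n) (mB n) s x).
- by move=> y xy; apply: (jump_rate_lower (AUB n) (AIB n)) => t; exact: near.
Qed.

Let dR_gt0 n s x : Omega x -> 0 < dR n s x.
Proof.
have [h [c [kappa [M [[_ kappa0 _ _ _] bar]]]]] := rate_barrier => Ox.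
exact: lt_le_trans kappa0 (bar n s x Ox).1.
Qed.

Let m_dR n s : measurable_fun setT (dR n s).
Proof.
apply: (@measurable_Rintegral_param _ _ _ _ _ leb
  (fun p : Rn * Rn => jump_rate J G K (A n) (B n) s p.1 p.2)).
have m_t t := measurable_funM (nonlocal_kernel_measurable (hV s t))
  (measurableT_comp (m_chi n t) measurable_snd).
exact: (measurable_funD (m_t true) (m_t false)).
Qed.

Let m_gR n s : measurable_fun setT (gR n s).
Proof.
apply: (@measurable_Rintegral_param _ _ _ _ _ leb
  (fun p : Rn * Rn => jump_rate J G K (A n) (B n) s p.1 p.2 * U n p.2)).
have m_t t := measurable_funM (nonlocal_kernel_measurable (hV s t))
  (measurableT_comp (m_chi n t) measurable_snd).
apply: measurable_funM; first exact: (measurable_funD (m_t true) (m_t false)).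
exact: measurableT_comp (integrable_measurable (i_U n)) measurable_snd.
Qed.

Let m_phi n s : measurable_fun setT (phi n s).
Proof.
apply: measurable_funM; first exact: measurable_indic.
apply: measurable_funM; first exact: measurable_funB.
apply: measurable_fun_inv_nonneg => // x; apply: Rintegral_ge0 => y _.
exact: jump_rate_ge0.
Qed.

Let phiE n s x : Omega x -> dR n s x * phi n s x = gR n s x - f0 x.
Proof.
move=> Ox; rewrite /phi indicE mem_set// mul1r mulrC -mulrA mulVf ?mulr1//.
by rewrite gt_eqF// dR_gt0.
Qed.

Let chi_phi n s : {ae leb, forall x, Omega x -> chi n s x * phi n s x = chi n s x * U n x}.
Proof.
have := dirichlet_phase_equation hJ hG hK mO bO (mA n) (mB n) (AUB n) (AIB n) (hu n).
apply: filterS => x /[swap] Ox /(_ Ox s) eqx.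
have d0 : dR n s x != 0 by rewrite gt_eqF// dR_gt0.
apply: (mulfI d0); rewrite mulrCA phiE// [RHS]mulrCA.
by rewrite /U /cut_off indicE mem_set// mul1r eqx f0E.
Qed.

Let i_phase (w : bool * Rn -> R) : (forall s, integrableR (fun x => w (s, x))) ->
  muZ.-integrable setT (EFin \o w).
Proof.
move=> iw; apply: (integrable_phaseP mO muO _).1 => [|s].
  by apply: (measurable_phaseP w).1 => s; exact: integrable_measurable (iw s).
by apply: integrableS (iw s).
Qed.

Let i_chiU n s : integrableR (fun x => chi n s x * U n x).
Proof. exact: i_chi. Qed.

Let gR_lifted n s x w : Omega x -> muZ.-integrable setT (EFin \o w) ->
  (forall t, {ae leb, forall y, Omega y -> w (t, y) = chi n t y * U n y}) ->
  kernel_op muZ (lifted_kernel J G K Omega) w (s, x) = gR n s x.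
Proof.
by move=> Ox iw wE; apply: kernel_op_lifted => //; exact: U_out.
Qed.

Let gR_bounded n : exists2 L, 0 <= L & forall s x, Omega x -> `|gR n s x| <= L.
Proof.
have [C hC] := lifted_kernelP hJ hG hK mO bO.
pose w (z : bool * Rn) := chi n z.1 z.2 * U n z.2.
have iw : muZ.-integrable setT (EFin \o w) by apply: i_phase => s; exact: i_chiU.
exists (`|C * \int[muZ]_z `|w z| |) => // s x Ox.
rewrite -(@gR_lifted n s x w Ox iw); last by move=> t; exact: aeW.
by rewrite (le_trans (kernel_op_bound hC _ iw))// ler_norm.
Qed.

Let i_phi n s : integrableR (phi n s).
Proof.
have [h [c [kappa [M [[_ kappa0 _ _ _] bar]]]]] := rate_barrier.
have [L L0 gL] := gR_bounded n.
apply: (@integrable_dominated _ _ _ _ _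
  (fun x => kappa^-1 * (L * \1_Omega x + `|f0 x|))) => //.
  apply: integrable_scale; apply: integrableRD; last exact: integrable_norm_fun.
  by apply: integrable_scale; exact: integrable_indic_Omega.
move=> x; have [Ox|Ox] := pselect (Omega x); last first.
  by rewrite phi_out// normr0 mulr_ge0 ?invr_ge0 ?(ltW kappa0)// addr_ge0// mulr_ge0.
rewrite /phi indicE mem_set// mul1r normrM mulrC mulr1 normfV.
rewrite (gtr0_norm (dR_gt0 n s Ox)).
have dk := (bar n s x Ox).1.
apply: ler_pM => //.
- by rewrite invr_ge0 ltW// dR_gt0.
- by rewrite lef_pV2// posrE dR_gt0.
- by rewrite (le_trans (ler_normB _ _))// lerD2r gL.
Qed.

Let phi_cvg : (forall s x, cvgn (fun n => phi n s x)) /\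
  exists C1 C2, [/\ 0 <= C1, 0 <= C2 & forall n s x, `|phi n s x| <= C1 + C2 * `|f0 x|].
Proof.
have [C hC] := lifted_kernelP hJ hG hK mO bO.
have [h [c [kappa [M [[c0 kappa0 mh hM h_out] bar]]]]] := rate_barrier.
(* Outside [Omega] the constant [c] is the supersolution. *)
pose H (z : bool * Rn) := if z.2 \in Omega then h z.2 else c.
pose Dlim (z : bool * Rn) := if z.2 \in Omega then rate_limit z.1 z.2 else 1.
have m2 : measurable_fun setT (fun z : bool * Rn => z.2 \in Omega).
  apply: (measurable_fun_bool true); rewrite setTI.
  rewrite (_ : _ @^-1` _ = snd @^-1` Omega).
    by rewrite -[X in measurable X]setTI; exact: measurable_snd.
  by apply/seteqP; split => z /=; [move=> /set_mem|exact: mem_set].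
have kernel_out w s x : ~ Omega x -> kernel_op muZ (lifted_kernel J G K Omega) w (s, x) = 0.
  move=> Ox; transitivity (\int[muZ]_z (cst 0 z : R)).
    by apply: eq_Rintegral => z _; rewrite /lifted_kernel/= !indicE (memNset Ox) !mul0r.
  by rewrite Rintegral_cst// mul0r.
have i_h : integrableR h.
  apply: (@integrable_dominated _ _ _ _ _ (fun x => M * \1_Omega x)) => //.
    by apply: integrable_scale; exact: integrable_indic_Omega.
  move=> x; rewrite indicE; have /andP[hx0 hxM] := hM x.
  case: (boolP (x \in Omega)) => [_|/negP Ox]; first by rewrite mulr1 ger0_norm.
  by rewrite h_out ?normr0 ?mulr0// => /mem_set.
have i_F0 : muZ.-integrable setT (EFin \o F0) by exact: i_phase.
have i_Phi n : muZ.-integrable setT (EFin \o Phi n).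
  by apply: i_phase => s; exact: i_phi.
have mTheta n : measurable_fun setT (Theta n).
  by apply: (measurable_phaseP (Theta n)).1 => s; exact: m_chi.
have Theta_cvg w : muZ.-integrable setT (EFin \o w) ->
    cvgn (fun n => \int[muZ]_z (Theta n z * w z)).
  move=> iw; have mw := integrable_measurable iw.
  pose w1 s := (fun x => w (s, x)) \_ Omega.
  have iw1 s : integrableR (w1 s).
    have := (integrable_mkcond _ mO).1 ((integrable_phaseP mO muO mw).2 iw s).
    by rewrite restrict_EFin.
  have ThetaE n : \int[muZ]_z (Theta n z * w z) =
      \int[leb]_x (chi n true x * w1 true x) + \int[leb]_x (chi n false x * w1 false x).
    rewrite Rintegral_phase.
      rewrite !(@Rintegral_mkcond _ _ _ _ Omega); congr (_ + _); apply: eq_Rintegral => x _;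
        by rewrite /w1 /patch; case: ifPn => // _; rewrite mulr0.
    by apply: (integrable_mul_bounded (C := 1)) => // z; exact: phase_indic_norm.
  under eq_fun do rewrite ThetaE.
  by apply: is_cvgD; apply/cvg_ex; eexists; exact: chi_cvg.
have mDn n : measurable_fun setT (Dn n).
  apply: (measurable_fun_ifT m2); last exact: measurable_cst.
  by apply: (measurable_phaseP (fun z => dR n z.1 z.2)).1 => s; exact: m_dR.
have mH : measurable_fun setT H.
  apply: (measurable_fun_ifT m2); last exact: measurable_cst.
  exact: measurableT_comp mh measurable_snd.
have km0 : 0 < Num.min kappa 1 by rewrite lt_min kappa0 ltr01.
have Dn_ge n z : Num.min kappa 1 <= Dn n z.
  rewrite /Dn; case: ifPn => [/set_mem Oz|_]; rewrite ge_min ?lexx ?orbT//.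
  by rewrite (bar n z.1 z.2 Oz).1.
have Dn_le n z : Dn n z <= 2.
  rewrite /Dn; case: ifPn => _; last by rewrite ler1n.
  exact: (total_rate_le2 hJ hG hK (mA n) (mB n)).
have Dn_cvg z : Dn n z @[n --> \oo] --> Dlim z.
  rewrite /Dn /Dlim; case: ifPn => _; [exact: dR_cvg|exact: cvg_cst].
have H0M z : 0 <= H z <= Num.max M c.
  rewrite /H; case: ifPn => _; rewrite le_max; last by rewrite (ltW c0) lexx orbT.
  by have /andP[-> ->] := hM z.2.
have i_ThetaH n : muZ.-integrable setT (EFin \o (fun z => Theta n z * H z)).
  apply: (integrable_mul_bounded (C := 1)) => //.
    by move=> z; exact: phase_indic_norm.
  apply: (@integrable_dominated _ _ _ _ _ (cst (Num.max M c))) => //.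
    exact: finite_measure_integrable_cst.
  by move=> z; have /andP[h0 h1] := H0M z; rewrite ger0_norm.
have sup n z : kernel_op muZ (lifted_kernel J G K Omega) (fun y => Theta n y * H y) z + c <=
    Dn n z * H z.
  move: z => [s x]; have [Ox|Ox] := pselect (Omega x); last first.
    by rewrite kernel_out// /Dn /H/= memNset// mul1r add0r.
  rewrite (@kernel_op_lifted _ _ _ _ _ hJ hG hK _ mO bO (A n) (B n) _ _ _ h)//; last first.
    by move=> t; apply: aeW => y Oy; rewrite /Theta /H/= mem_set.
  by rewrite /Dn /H/= mem_set//; exact: (bar n s x Ox).2.
have eqPhi n z : Dn n z * Phi n z =
    kernel_op muZ (lifted_kernel J G K Omega) (fun y => Theta n y * Phi n y) z - F0 z.
  move: z => [s x]; have [Ox|Ox] := pselect (Omega x); last first.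
    by rewrite kernel_out// /Dn /Phi /F0/= memNset// mul1r phi_out// f0_out// subr0.
  rewrite (@gR_lifted n)//; last by move=> t; exact: chi_phi.
    by rewrite /Dn /Phi /F0/= mem_set// phiE.
  by apply: i_phase => t; exact: (i_chi n t (i_phi n t)).
have [cvgPhi [C1 [C2 [C10 C20 bound]]]] := solutions_pointwise_cvg hC mTheta
  (fun n z => phase_indic01 (A n) (B n) z.1 z.2) Theta_cvg mDn km0 Dn_ge Dn_le Dn_cvg
  mH H0M c0 sup i_F0 i_Phi eqPhi.
split=> [s x|]; first exact: (cvgPhi (s, x)).
by exists C1, C2; split => // n s x; exact: (bound n (s, x)).
Qed.

Let philim s x := limn (fun n => phi n s x).

Let ulim s x := xi s x * philim s x.

Let philim_cvg s x : phi n s x @[n --> \oo] --> philim s x.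
Proof. exact: phi_cvg.1. Qed.

Let philim_out s x : ~ Omega x -> philim s x = 0.
Proof.
move=> Ox; rewrite /philim (_ : (fun n => _) = cst 0) ?lim_cst//.
by apply/funext => n; rewrite phi_out.
Qed.

Let m_philim s : measurable_fun setT (philim s).
Proof. by apply: measurable_fun_cvg (fun n => m_phi n s) _ => x _; exact: philim_cvg. Qed.

Let philim_L2 s : philim s \in Lfun leb 2%:E.
Proof.
have [_ [C1 [C2 [C10 C20 bound]]]] := phi_cvg.
apply: sqr_integrable_Lfun2 => //.
have i_f02 : integrableR (fun x => f0 x ^+ 2) by exact: Lfun2_integrable_sqr hf.
apply: (@integrable_dominated _ _ _ _ _
  (fun x => 2 * C1 ^+ 2 * \1_Omega x + 2 * C2 ^+ 2 * f0 x ^+ 2)).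
- exact: measurable_funX.
- by apply: integrableRD; apply: integrable_scale => //; exact: integrable_indic_Omega.
move=> x; rewrite normrX; have [Ox|Ox] := pselect (Omega x); last first.
  rewrite philim_out// normr0 expr0n/= indicE (memNset Ox) mulr0 add0r.
  by rewrite mulr_ge0 ?sqr_ge0// mulr_ge0// sqr_ge0.
have b : `|philim s x| <= C1 + C2 * `|f0 x|.
  have cn : `|phi n s x| @[n --> \oo] --> `|philim s x|.
    by apply: cvg_norm; exact: philim_cvg.
  rewrite -(cvg_lim (@Rhausdorff R) cn); apply: limr_le.
    by apply/cvg_ex; exists `|philim s x|.
  by apply: nearW => n; exact: bound.
rewrite indicE mem_set// mulr1 -[f0 x ^+ 2](real_normK (num_real _)).
apply: (@le_trans _ _ ((C1 + C2 * `|f0 x|) ^+ 2)).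
  by rewrite lerXn2r ?nnegrE// addr_ge0// mulr_ge0.
by rewrite -mulrA -exprMn sqrrD_le.
Qed.

Let ulim_L2 s : ulim s \in Lfun leb 2%:E.
Proof.
have m_ulim : measurable_fun setT (ulim s).
  by have [m_xi _] := xi_bounded s; exact: (measurable_funM m_xi (m_philim s)).
apply: sqr_integrable_Lfun2 => //.
have i2 := Lfun2_integrable_sqr (philim_L2 s).
have := integrable_mul_essentially_bounded (xi_bounded s)
  (integrable_mul_essentially_bounded (xi_bounded s) i2).
by apply: eq_integrable => // x _ /=; rewrite /ulim; congr EFin; ring.
Qed.

Let ulim_out s x : ~ Omega x -> ulim s x = 0.
Proof. by move=> Ox; rewrite /ulim philim_out// mulr0. Qed.

Let ulim_weak_cvg s : weak_cvg_L2 Omega (fun n x => chi n s x * u n x) (ulim s).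
Proof.
move=> g; rewrite /L2; set g0 := patch _ Omega g => hg.
have [_ [C1 [C2 [C10 C20 bound]]]] := phi_cvg.
have g0_out x : ~ Omega x -> g0 x = 0 by move=> Ox; rewrite /g0 /patch memNset.
have i_g0 : integrableR g0 by exact: L2_integrable.
have m_g0 := integrable_measurable i_g0.
have i_fg : integrableR (fun x => f0 x * g0 x) by exact: Lfun2_mul_integrable.
have m_u n : measurable_fun setT (u n).
  by have [[+ _] _] := hu n; rewrite inE => /andP[/[!inE]].
have -> : \int[leb]_(x in Omega) (ulim s x * g x) =
    \int[leb]_x (xi s x * (philim s x * g0 x)).
  rewrite Rintegral_mkcond; apply: eq_Rintegral => x _.
  by rewrite /g0 /patch /ulim; case: ifPn => _; rewrite ?mulr0// mulrA.
have -> : (fun n => \int[leb]_(x in Omega) (chi n s x * u n x * g x)) =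
    (fun n => \int[leb]_x (chi n s x * (phi n s x * g0 x))).
  apply/funext => n; rewrite Rintegral_mkcond; apply: ae_eq_Rintegral.
  - rewrite (_ : _ \_ _ = fun x => chi n s x * u n x * g0 x).
      exact: (measurable_funM (measurable_funM (m_chi n s) (m_u n)) m_g0).
    by apply/funext => x; rewrite /g0 /patch; case: ifPn => _; rewrite ?mulr0.
  - exact: (measurable_funM (m_chi n s) (measurable_funM (m_phi n s) m_g0)).
  - apply: filterS (chi_phi n s) => x chiE; rewrite /g0 /patch.
    case: ifPn => [/set_mem Ox|_]; last by rewrite !mulr0.
    by rewrite mulrA chiE// /U /cut_off indicE mem_set// mul1r.
apply: (@weak_star_mul_dominated_cvg _ _ _ leb _ _ _ _
  (fun x => C1 * `|g0 x| + C2 * `|f0 x * g0 x|)).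
- by move=> n; exact: m_chi.
- by move=> n x; exact: phase_indic_norm.
- by move=> v iv; exact: chi_cvg.
- by move=> n; exact: (measurable_funM (m_phi n s) m_g0).
- by move=> x; apply: cvgM; [exact: philim_cvg|exact: cvg_cst].
- by apply: integrableRD; apply: integrable_scale; exact: integrable_norm_fun.
- move=> n x; rewrite [leLHS]normrM [`|f0 x * _|]normrM [C2 * _]mulrA -mulrDl.
  by rewrite ler_wpM2r.
Qed.

Let gR_limit s x := \int[leb]_y (V s true x y * ulim true y) +
  \int[leb]_y (V s false x y * ulim false y).

(** The section of a kernel at a point of [Omega] is a test function in L2(Omega). *)
Let gR_cvg s x : Omega x -> gR n s x @[n --> \oo] --> gR_limit s x.
Proof.
move=> Ox; have [C C0 hC] := phase_kernel_bounded hJ hG hK bO.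
have V_L2 t : L2 Omega (V s t x).
  rewrite /L2; set v := patch _ _ _.
  have mv : measurable_fun setT v.
    apply/(measurable_restrictT _ mO)/measurable_funTS.
    exact: (measurable_nonlocal_kernel (hV s t)).
  apply: sqr_integrable_Lfun2 => //.
  apply: (@integrable_dominated _ _ _ _ _ (fun y => C ^+ 2 * \1_Omega y)).
  - exact: measurable_funX.
  - by apply: integrable_scale; exact: integrable_indic_Omega.
  - move=> y; rewrite /v /patch indicE normrX; case: (boolP (y \in Omega)) => [/set_mem Oy|_].
      have V0 := nonlocal_kernel_ge0 (hV s t) x y.
      by rewrite mulr1 ger0_norm// lerXn2r ?nnegrE// hC.
    by rewrite normr0 expr0n/= mulr0.
have -> : gR_limit s x = \int[leb]_(y in Omega) (ulim true y * V s true x y) +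
    \int[leb]_(y in Omega) (ulim false y * V s false x y).
  rewrite /gR_limit !(@Rintegral_mkcond _ _ _ _ Omega); congr (_ + _); apply: eq_Rintegral => y _;
    rewrite /patch; case: ifPn => [_|/negP Oy]; rewrite 1?mulrC//;
    by rewrite ulim_out ?mul0r// => /mem_set.
have -> : (fun n => gR n s x) =
    (fun n => \int[leb]_(y in Omega) (chi n true y * u n y * V s true x y) +
      \int[leb]_(y in Omega) (chi n false y * u n y * V s false x y)).
  apply/funext => n.
  have i_t t : integrableR (fun y => chi n t y * (V s t x y * U n y)).
    by apply: i_chi; apply: (integrable_phase_kernel_mul hJ hG hK bO) => //; exact: U_out.
  transitivity (\int[leb]_y (chi n true y * (V s true x y * U n y)) +
      \int[leb]_y (chi n false y * (V s false x y * U n y))).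
    rewrite -RintegralD//; apply: eq_Rintegral => y _.
    by rewrite /jump_rate; ring.
  rewrite !(@Rintegral_mkcond _ _ _ _ Omega); congr (_ + _); apply: eq_Rintegral => y _;
    rewrite /patch /U /cut_off indicE; case: (y \in Omega) => /=;
    by [ring|rewrite mul0r !mulr0].
by apply: cvgD; exact: ulim_weak_cvg.
Qed.

Let ulim_eq s x : Omega x -> ulim s x * rate_limit s x = xi s x * (gR_limit s x - f x).
Proof.
move=> Ox; rewrite /ulim -mulrA; congr (_ * _).
have c1 : dR n s x * phi n s x @[n --> \oo] --> rate_limit s x * philim s x.
  by apply: cvgM; [exact: dR_cvg|exact: philim_cvg].
have c2 : gR n s x - f0 x @[n --> \oo] --> gR_limit s x - f x.
  by rewrite -(f0E Ox); apply: cvgB; [exact: gR_cvg|exact: cvg_cst].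
have e : (fun n => dR n s x * phi n s x) = (fun n => gR n s x - f0 x).
  by apply/funext => n; exact: phiE.
rewrite e in c1.
by rewrite mulrC; exact: cvg_unique c1 c2.
Qed.

Lemma phase_limits : exists uA uB : Rn -> R, [/\ L2 Omega uA /\ L2 Omega uB,
  forall x, ~ Omega x -> uA x = 0 /\ uB x = 0,
  weak_cvg_L2 Omega (fun n x => \1_(A n) x * u n x) uA,
  weak_cvg_L2 Omega (fun n x => \1_(B n) x * u n x) uB &
  limit_system J G K Omega X f uA uB].
Proof.
have ulimE s : patch (fun=> 0) Omega (ulim s) = ulim s.
  apply/funext => x; rewrite /patch; case: ifPn => // /negP Ox.
  by rewrite ulim_out// => /mem_set.
have i_u s : integrableR (ulim s) by apply: L2_integrable => //; exact: ulim_out.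
exists (ulim true), (ulim false); split.
- by split; rewrite /L2 ulimE; exact: ulim_L2.
- by move=> x Ox; split; exact: ulim_out.
- exact: ulim_weak_cvg true.
- exact: ulim_weak_cvg false.
apply: aeW => x Ox.
have part s t : \int[leb]_y (V s t x y * (xi s x * ulim t y - ulim s x * xi t y)) =
    xi s x * \int[leb]_y (V s t x y * ulim t y) -
    ulim s x * \int[leb]_y (V s t x y * xi t y).
  have i1 : integrableR (fun y => V s t x y * ulim t y).
    by apply: (integrable_phase_kernel_mul hJ hG hK bO) => //; exact: ulim_out.
  have i2 : integrableR (fun y => V s t x y * xi t y).
    have := integrable_mul_essentially_bounded (xi_bounded t)
      (integrable_nonlocal_kernel (hV s t) x).
    by apply: eq_integrable => // y _ /=; rewrite mulrC.
  rewrite -!RintegralZl// -RintegralB//; [|exact: integrable_scale..].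
  by apply: eq_Rintegral => y _; rewrite mulrBr; congr (_ - _); exact: mulrCA.
have total s : xi s x * f x =
    \int[leb]_y (V s true x y * (xi s x * ulim true y - ulim s x * xi true y)) +
    \int[leb]_y (V s false x y * (xi s x * ulim false y - ulim s x * xi false y)).
  rewrite !part addrACA -opprD -!mulrDr [X in _ - X](ulim_eq s Ox) -mulrBr.
  by rewrite subKr.
split.
- rewrite -[X x]/(xi true x) total; congr (_ + _); apply: eq_Rintegral => y _ //.
  by congr (_ * (_ - _)); exact: mulrC.
- rewrite -[1 - X x]/(xi false x) total; congr (_ + _);
    apply: eq_Rintegral => y _; congr (_ * (_ - _)); exact: mulrC.
Qed.

End limit.

(** * The theorem *)

(** The difference of the two limits is itself a test function. *)
Lemma weak_limit_unique (R : realType) (N : nat) (Omega : set 'rV[R]_N)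
    (v : ('rV[R]_N -> R)^nat) (w w' : 'rV[R]_N -> R) :
  L2 Omega w -> L2 Omega w' -> (forall x, ~ Omega x -> w x = 0 /\ w' x = 0) ->
  weak_cvg_L2 Omega v w -> weak_cvg_L2 Omega v w' ->
  {ae lebesgue_rV, forall x, w x = w' x}.
Proof.
move=> hw hw' w_out cw cw'; set leb := @lebesgue_rV R N.
have patchE (g : 'rV[R]_N -> R) : (forall x, ~ Omega x -> g x = 0) ->
    patch (fun=> 0) Omega g = g.
  move=> g_out; apply/funext => x; rewrite /patch; case: ifPn => // /negP Ox.
  by rewrite g_out// => /mem_set.
have w0 x : ~ Omega x -> w x = 0 by move=> /w_out[].
have w'0 x : ~ Omega x -> w' x = 0 by move=> /w_out[].
move: hw hw'; rewrite /L2 !patchE// => hw hw'.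
pose g x := w x - w' x.
have g_out x : ~ Omega x -> g x = 0 by move=> Ox; rewrite /g w0// w'0// subr0.
have m_lfun (p : 'rV[R]_N -> R) : p \in Lfun leb 2%:E -> measurable_fun setT p.
  by rewrite inE => /andP[/[!inE]].
have mg : measurable_fun setT g := measurable_funB (m_lfun _ hw) (m_lfun _ hw').
have hg : g \in Lfun leb 2%:E.
  apply: (sqr_integrable_Lfun2 mg).
  apply: (@integrable_dominated _ _ _ _ _ (fun x => 2 * w x ^+ 2 + 2 * w' x ^+ 2)).
  - exact: measurable_funX.
  - by apply: integrableRD; apply: integrable_scale; exact: Lfun2_integrable_sqr.
  - by move=> x; rewrite normrX real_normK ?num_real// -(sqrrN (w' x)) sqrrD_le.
have g_L2 : L2 Omega g by rewrite /L2 patchE.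
have eq_g := cvg_unique (@Rhausdorff R) (cw g g_L2) (cw' g g_L2).
have toT (h : 'rV[R]_N -> R) : \int[leb]_(x in Omega) (h x * g x) = \int[leb]_x (h x * g x).
  rewrite [LHS]Rintegral_mkcond; apply: eq_Rintegral => x _; rewrite /patch.
  by case: ifPn => // /negP Ox; rewrite g_out ?mulr0// => /mem_set.
rewrite !toT in eq_g.
have i_g2 := Lfun2_integrable_sqr hg.
have int0 : \int[leb]_x (g x ^+ 2) = 0.
  transitivity (\int[leb]_x (w x * g x) - \int[leb]_x (w' x * g x)).
    rewrite -RintegralB//; [|exact: Lfun2_mul_integrable..].
    by apply: eq_Rintegral => x _; rewrite expr2 -mulrBl.
  by rewrite eq_g subrr.
have : ae_eq leb setT (fun x => (g x ^+ 2)%:E) (cst 0%E).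
  apply/ae_eq_integral_abs => //; first exact: measurable_int i_g2.
  rewrite -[RHS](congr1 EFin int0) EFin_Rintegral//; apply: eq_integral => x _.
  by rewrite gee0_abs// lee_fin sqr_ge0.
apply: filterS => x /(_ I)[] /eqP; rewrite sqrf_eq0 subr_eq0 => /eqP.
exact.
Qed.

Lemma weak_cvg_L2_shift (R : realType) (N : nat) (Omega : set 'rV[R]_N)
    (v : ('rV[R]_N -> R)^nat) (w : 'rV[R]_N -> R) :
  weak_cvg_L2 Omega (fun n => v n.+1) w <-> weak_cvg_L2 Omega v w.
Proof.
by split=> cv g hg; have := cv g hg;
  rewrite (cvg_shiftS (fun n => \int[lebesgue_rV]_(x in Omega) (v n x * g x))).
Qed.

Theorem theorem2p3 (R : realType) (N : nat) (N_gt0 : (0 < N)%N)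
  (Omega : set 'rV[R]_N)
  (Omega_open : open Omega) (Omega_connected : connected Omega)
  (Omega_bounded : bounded_set Omega)
  (J G K : 'rV[R]_N -> 'rV[R]_N -> R)
  (hJ : nonlocal_kernel J) (hG : nonlocal_kernel G) (hK : nonlocal_kernel K)
  (A B : nat -> set 'rV[R]_N)
  (mA : forall n, (1 <= n)%N -> measurable (A n))
  (mB : forall n, (1 <= n)%N -> measurable (B n))
  (AUB : forall n, (1 <= n)%N -> A n `|` B n = setT)
  (AIB : forall n, (1 <= n)%N -> A n `&` B n = set0)
  (X : 'rV[R]_N -> R) (hX : X \in Lfun lebesgue_rV +oo%E)
  (f : 'rV[R]_N -> R) (hf : L2 Omega f)
  (u : nat -> 'rV[R]_N -> R)
  (hu : forall n, (1 <= n)%N ->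
    dirichlet_solution J G K Omega (A n) (B n) f (u n))
  (hAX : weak_star_cvg (fun n => \1_(A n)) X) :
  exists uA uB : 'rV[R]_N -> R,
    limit_pair J G K Omega A B u X f uA uB /\
    forall vA vB : 'rV[R]_N -> R,
      limit_pair J G K Omega A B u X f vA vB ->
      {ae lebesgue_rV, forall x, vA x = uA x /\ vB x = uB x}.
Proof.
have mO := open_measurable_rV Omega_open.
have hAX' : weak_star_cvg (fun n => \1_(A n.+1)) X.
  move=> g hg; have := hAX g hg.
  by rewrite -(cvg_shiftS (fun n => \int[lebesgue_rV]_x (\1_(A n) x * g x))).
have [uA [uB [uL2 u_out cA cB sys]]] := phase_limits (Ordinal N_gt0) mO Omega_bounded
  hJ hG hK (fun n => mA n.+1 (ltn0Sn n)) (fun n => mB n.+1 (ltn0Sn n)) (fun n => AUB n.+1 (ltn0Sn n))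
  (fun n => AIB n.+1 (ltn0Sn n)) hX hf (fun n => hu n.+1 (ltn0Sn n)) hAX'.
have {}cA := (weak_cvg_L2_shift Omega (fun n x => \1_(A n) x * u n x) uA).1 cA.
have {}cB := (weak_cvg_L2_shift Omega (fun n x => \1_(B n) x * u n x) uB).1 cB.
exists uA, uB; split=> [|vA vB [[vA2 vB2] v_out cvA cvB _]]; first by split.
have [uA2 uB2] := uL2.
have eqA : {ae lebesgue_rV, forall x, vA x = uA x}.
  apply: weak_limit_unique vA2 uA2 _ cvA cA => x Ox.
  by split; [have [] := v_out x Ox|have [] := u_out x Ox].
have eqB : {ae lebesgue_rV, forall x, vB x = uB x}.
  apply: weak_limit_unique vB2 uB2 _ cvB cB => x Ox.
  by split; [have [] := v_out x Ox|have [] := u_out x Ox].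
by apply: filterS2 eqA eqB.
Qed.
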